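(* Let $\{\mu^N\}_{N\in\mathbb{N}}$ be probability measures on the configuration space $\mathsf{S}$ over $S\subset\mathbb{R}^d$, $d\in\{1,2\}$ ($\mathbb{R}^2$ regarded as $\mathbb{C}$). Let $\beta\in\mathbb{R}$, $\Psi(x,y)=-\beta\log|x-y|$ and $\Psi^N(x,y)=-\beta\log|\varpi_N(x)-\varpi_N(y)|$, where either (first case) $d\in\{1,2\}$ and $\varpi_N(x)=x$ for all $N$, or (second case) $d=1$ and $\varpi_N$ is the map given in the context. Suppose that condition (A.6) holds: for each $r\in\mathbb{N}$ there exists $\ell_0\in\mathbb{N}$ such that $$\lim_{k\to\infty}\limsup_{N\to\infty}\mu^N(\bar{\mathsf{U}}_{r,\ell_0,k}^c)=0\quad\text{and}\quad\lim_{k\to\infty}\limsup_{N\to\infty}\mu^N(\mathsf{U}_{r,\ell,k}^c)=0\ \text{ for all }1\le\ell<\ell_0$$ (the second requirement being void when $\ell_0=1$). Then condition (A.5) holds: $$\lim_{k\to\infty}\limsup_{N\to\infty}\mu^N(\mathsf{H}_{r,k}^c)=0\quad\text{for all }r\in\mathbb{N}.$$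
   Context: $S\subset\mathbb{R}^d$ is closed with $0\in S$ and $\overline{S^{\mathrm{int}}}=S$. $\mathsf{S}$ is the set of measures $\mathsf{s}=\sum_i\delta_{s_i}$, $(s_i)$ a (finite or countable) sequence in $S$, with $\mathsf{s}(K)<\infty$ for every compact $K$, with the vague topology. $\{b_r\}$ is a fixed increasing sequence of natural numbers, $S_r=\{s\in S:|s|<b_r\}$, $S_{rs}=S_s\setminus S_r$ for $r<s$, $S_{r\infty}=S\setminus S_r$. **Second case.** Let $I_N=(-N,N)$, $n_N=2^{4N}$, and $\varpi_N:S\to\mathbb{C}$, $\varpi_N(x)=\mathrm{i}\frac{n_N}{2\pi}(1-e^{2\pi\mathrm{i}x/n_N})$ for $x\in I_N$, $\varpi_N(x)=x$ for $x\in I_{N+1}^c$, and linear interpolation for $x\in I_{N+1}\setminus I_N$. In both cases $\bar\varpi_N$ denotes the complex conjugate of $\varpi_N$. For $\mathsf{y}=\sum_i\delta_{y_i}$ and $r,\ell,k\in\mathbb{N}$ put $$\mathsf{U}_{r,\ell,k}=\Bigl\{\mathsf{y}\in\mathsf{S}:\sup_{N\in\mathbb{N}}\sup_{r<s\in\mathbb{N}}\Bigl|\sum_{y_i\in S_{rs}}\frac{1}{\bar\varpi_N(y_i)^\ell}\Bigr|\le k\Bigr\},$$ $$\bar{\mathsf{U}}_{r,\ell,k}=\Bigl\{\mathsf{y}\in\mathsf{S}:\sup_{N\in\mathbb{N}}\sum_{y_i\in S_{r\infty}}\frac{1}{|\varpi_N(y_i)|^\ell-|\varpi_N(b_r)|^\ell}\le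 k\Bigr\}$$ (with $1/0=\infty$), and, with $\Psi^N_{r,rs}(x,\mathsf{y})=\sum_{y_i\in S_{rs}}\Psi^N(x,y_i)$, $$\mathsf{H}_{r,k}=\Bigl\{\mathsf{y}\in\mathsf{S}:\sup_{N\in\mathbb{N}}\sup_{r<s\in\mathbb{N}}\sup_{x\ne w\in S_r}\frac{|\Psi^N_{r,rs}(x,\mathsf{y})-\Psi^N_{r,rs}(w,\mathsf{y})|}{|x-w|}\le k\Bigr\}.$$ *)

(* Defs.v *)
From HB Require Import structures.
From mathcomp Require Import all_boot all_order all_algebra.
From mathcomp Require Import all_classical all_reals all_analysis.
From mathcomp Require Import complex.

Set Implicit Arguments.
Unset Strict Implicit.
Unset Printing Implicit Defensive.

Import Order.TTheory GRing.Theory Num.Theory numFieldNormedType.Exports.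

Local Open Scope classical_set_scope.
Local Open Scope ring_scope.

(* The natural numbers are {1, 2, ...}: an index ranging over them is
   given here by a [nat] together with a positivity condition. *)

Section Plane.
Context {R : realType}.

Definition cabs (z : R[i]) : R := ComplexField.Normc.normc z.

Context {d : nat}.

(* Euclidean norm; the norm MathComp-Analysis puts on matrices is the sup
   norm, which induces the same topology. *)
Definition enorm (x : 'rV[R]_d) : R := Num.sqrt (\sum_(j < d) x 0 j ^+ 2).

(* R^1 as the real axis of C, and R^2 as C: x_0 + i x_1 (meant for d = 1, 2) *)
Definition toC (x : 'rV[R]_d) : R[i] := \sum_(j < d) (x 0 j)%:C%C * 'i%C ^+ j.

(* the real number t seen as a point of R^d, e.g. (t, 0) when d = 2 *)
Definition real_point (t : R) : 'rV[R]_d :=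
  \row_(j < d) (if (j == 0 :> nat) then t else 0).

End Plane.

Section CircleMap.
Context {R : realType}.

Definition circle_length (N : nat) : R := (2 ^ (4 * N))%:R.

Definition circle_inner (N : nat) (x : R) : R[i] :=
  let n := circle_length N in
  let t := 2 * pi * x / n in
  'i%C * (n / (2 * pi))%:C%C * (1 - (cos t +i* sin t)%C).

(* On N <= |x| < N + 1 the interpolation is done on each of the two
   components, between sg(x) N and sg(x) (N + 1). *)
Definition circle_map (N : nat) (x : R) : R[i] :=
  if `|x| < N%:R then circle_inner N x
  else if N.+1%:R <= `|x| then x%:C%C
  else (N.+1%:R - `|x|)%:C%C * circle_inner N (Num.sg x * N%:R)
       + (`|x| - N%:R)%:C%C * (Num.sg x * N.+1%:R)%:C%C.

End CircleMap.

Definition borel_space (R : realType) (d : nat) :=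
  g_sigma_algebraType (@open 'rV[R]_d).

(* The measure \sum_i \delta_{s_i} is required to be given by this formula on
   all subsets, not only on Borel ones: a MathComp-Analysis measure is a function
   on all subsets, so this makes equal measures equal as functions.
   The sequence (s_i) is indexed by a subset I of nat, so that it may be empty,
   finite or infinite. *)
Record config (R : realType) (d : nat) (S : set 'rV[R]_d) := Config {
  config_measure :> {measure set (borel_space R d) -> \bar R};
  config_atomic : exists L : set nat * (nat -> borel_space R d),
    (forall i, L.1 i -> S (L.2 i)) /\
    forall A : set (borel_space R d),
      config_measure A = (\esum_(i in L.1) \d_(L.2 i) A)%E;
  config_locally_finite : forall K : set 'rV[R]_d,
    compact K -> (config_measure K < +oo)%E }.

Section EmptyConfig.
Context {R : realType} {d : nat} (S : set 'rV[R]_d).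

Let m0 : {measure set (borel_space R d) -> \bar R} := mzero.

Let m0_atomic : exists L : set nat * (nat -> borel_space R d),
    (forall i, L.1 i -> S (L.2 i)) /\
    forall A : set (borel_space R d), m0 A = (\esum_(i in L.1) \d_(L.2 i) A)%E.
Proof.
by exists (set0, fun=> 0); split=> [//|A]; rewrite esum_set0.
Qed.

Let m0_locally_finite (K : set 'rV[R]_d) : compact K -> (m0 K < +oo)%E.
Proof. by move=> _; rewrite /m0/= /mzero ltry. Qed.

Definition empty_config : config S := Config m0_atomic m0_locally_finite.

End EmptyConfig.

HB.instance Definition _ (R : realType) (d : nat) (S : set 'rV[R]_d) :=
  gen_eqMixin (config S).
HB.instance Definition _ (R : realType) (d : nat) (S : set 'rV[R]_d) :=
  gen_choiceMixin (config S).
HB.instance Definition _ (R : realType) (d : nat) (S : set 'rV[R]_d) :=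
  isPointed.Build (config S) (empty_config S).

Section Sums.
Context {R : realType} {d : nat} {S : set 'rV[R]_d}.

(* a choice of (I, s) with y = \sum_(i in I) \delta_{s_i}; the sums below do
   not depend on it *)
Definition labels (y : config S) : set nat * (nat -> 'rV[R]_d) :=
  projT1 (cid (config_atomic y)).

Definition labels_in (y : config S) (A : set 'rV[R]_d) : set nat :=
  [set i | (labels y).1 i /\ A ((labels y).2 i)].

(* \sum_(y_i in A) F(y_i), for sums with finitely many nonzero terms *)
Definition psum (V : nmodType) (y : config S) (A : set 'rV[R]_d)
    (F : 'rV[R]_d -> V) : V :=
  \sum_(i \in labels_in y A) F ((labels y).2 i).

(* \sum_(y_i in A) F(y_i), for nonnegative, possibly infinite, terms *)
Definition pesum (y : config S) (A : set 'rV[R]_d)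
    (F : 'rV[R]_d -> \bar R) : \bar R :=
  (\esum_(i in labels_in y A) F ((labels y).2 i))%E.

End Sums.

Section VagueTopology.
Context {R : realType} {d : nat} (S : set 'rV[R]_d).

(* continuous functions with compact support on S *)
Definition Cc : set ('rV[R]_d -> R) :=
  [set f | {within S, continuous f} /\
    exists2 K : set 'rV[R]_d, compact K & forall x, S x -> ~ K x -> f x = 0].

Definition vague_config :=
  sup_topology (fun f : {f : 'rV[R]_d -> R | Cc f} =>
    Topological.class
      (initial_topology (fun s : config S => psum s setT (sval f) : R))).

HB.instance Definition _ := Pointed.on vague_config.
HB.instance Definition _ := Topological.on vague_config.

(* the configuration space with the Borel sigma-algebra of the vague topology *)
Definition config_space := g_sigma_algebraType (@open vague_config).

End VagueTopology.

Section Conditions.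
Context {R : realType} {d : nat} (S : set 'rV[R]_d) (b : nat -> nat).

Definition S_ (r : nat) : set 'rV[R]_d := [set x | S x /\ enorm x < (b r)%:R].
Definition S_shell (r s : nat) : set 'rV[R]_d := S_ s `\` S_ r.
Definition S_out (r : nat) : set 'rV[R]_d := S `\` S_ r.

Context (varpi : nat -> 'rV[R]_d -> R[i]).

Definition U_ (r l k : nat) : set (config_space S) :=
  [set y : config S |
    (ereal_sup
      [set (cabs (psum y (S_shell r s)
                    (fun x => 1 / ((varpi N x)^* )%C ^+ l)))%:E
      | N in [set N | (0 < N)%N] & s in [set s | (r < s)%N]]
     <= k%:R%:E)%E].

(* [inve0] : 0^-1 = +oo in \bar R *)
Definition Ubar_ (r l k : nat) : set (config_space S) :=
  [set y : config S |
    (ereal_sup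
      [set pesum y (S_out r)
             (fun x => ((cabs (varpi N x) ^+ l
                         - cabs (varpi N (real_point (b r)%:R)) ^+ l)%:E)^-1)
      | N in [set N | (0 < N)%N]]
     <= k%:R%:E)%E].

Context (beta : R).

Definition PsiN (N : nat) (x y : 'rV[R]_d) : R :=
  - beta * ln (cabs (varpi N x - varpi N y)).

Definition PsiN_shell (N r s : nat) (x : 'rV[R]_d) (y : config S) : R :=
  psum y (S_shell r s) (PsiN N x).

Definition H_ (r k : nat) : set (config_space S) :=
  [set y : config S |
    (ereal_sup
      [set ereal_sup
        [set (`|PsiN_shell N r s xw.1 y - PsiN_shell N r s xw.2 y|
              / enorm (xw.1 - xw.2))%:E
        | xw in [set xw : 'rV[R]_d * 'rV[R]_d |
                  [/\ S_ r xw.1, S_ r xw.2 & xw.1 <> xw.2]]]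
      | N in [set N | (0 < N)%N] & s in [set s | (r < s)%N]]
     <= k%:R%:E)%E].

(* lim_(k -> oo) limsup_(N -> oo) mu^N ((A_k)^c) = 0 *)
Definition compl_vanish (mu : nat -> probability (config_space S) R)
    (A : nat -> set (config_space S)) : Prop :=
  (fun k => limn_esup (fun N => mu N (~` A k))) @ \oo --> 0%E.

End Conditions.

(* Main.v *)
Require Import Defs.
From mathcomp Require Import all_boot all_order all_algebra.
From mathcomp Require Import finmap.
From mathcomp Require Import all_classical all_reals all_analysis.
From mathcomp Require Import measurable_realfun complex.
From mathcomp Require Import ring lra.

Set Implicit Arguments.
Unset Strict Implicit.
Unset Printing Implicit Defensive.

Import Order.TTheory GRing.Theory Num.Theory numFieldNormedType.Exports.

Local Open Scope classical_set_scope.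
Local Open Scope ring_scope.

(* Let u range over the points varpi_N(y_i) outside S_r and put
   rho = |varpi_N(b_r)|, so that |z| < rho <= |u| for z = varpi_N(x), x in S_r.
   The logarithm ln|z - u| - ln|u| is minus the real part of the series
   sum_l (z / u)^l / l.  Summed over the y_i, the terms with l < l0 are Lipschitz
   in z by U_(r,l,k), and the remainder of order l0 has, along a segment, a
   derivative bounded by l0 rho^(l0-1) / (|u|^l0 - rho^l0), which Ubar_(r,l0,k)
   sums.  As varpi_N is Lipschitz on S_r uniformly in N, H_(r,Ck) contains the
   intersection of Ubar_(r,l0,k) with the U_(r,l,k), l < l0, for some constant C.

   Passing to mu^N needs these events to be Borel for the vague topology: the
   number of points in an open set is lower semicontinuous, hence the number of
   points in a Borel set and all sums over points are measurable, and in H the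
   points x, w may be taken rational since x -> Psi_(r,rs)(x, y) is continuous. *)

(** * Modulus of complex numbers and remainder of the logarithm *)

Section ComplexModulus.
Context {R : realType}.
Implicit Types z w : R[i].

(** The two cases are used through four properties of varpi_N: it fixes 0, it is Lipschitz for each
    N, it is Lipschitz on bounded sets uniformly in N, and |varpi_N| orders points exactly as |x|
    does. The bounds need the uniform constant, since C may not depend on N; measurability only
    needs one constant for each N. The order is the delicate property for the circle map. Between N
    and N + 1 the interpolation follows the segment from p = varpi_N(N) to N + 1, along which the
    modulus could at first decrease. It does not, because n_N = 2^(4N) is so large that the arc from
    0 to N is almost straight. The strict inequality rho < |u| is not a consequence of the order. It
    comes from Ubar itself: a point with |u| = rho would contribute 1/0 = oo. The denominator |u|^l0
    - rho^l0, and not just |u|^l0, is what the remainder requires, since |1 - z/u| may be small when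
    |u| is close to rho. *)

Lemma cabsE z : cabs z = Num.sqrt (complex.Re z ^+ 2 + complex.Im z ^+ 2).
Proof. by case: z. Qed.

Lemma sqr_cabs z : cabs z ^+ 2 = complex.Re z ^+ 2 + complex.Im z ^+ 2.
Proof. by rewrite cabsE sqr_sqrtr// addr_ge0// sqr_ge0. Qed.

Lemma cabs_ge0 z : 0 <= cabs z.
Proof. by rewrite cabsE sqrtr_ge0. Qed.

Lemma cabs0 : cabs (0 : R[i]) = 0.
Proof. by rewrite cabsE /= expr0n addr0 sqrtr0. Qed.

Lemma cabs_eq0 z : (cabs z == 0) = (z == 0).
Proof.
apply/eqP/eqP => [|->]; last exact: cabs0.
exact: ComplexField.Normc.eq0_normc.
Qed.

Lemma cabsM z w : cabs (z * w) = cabs z * cabs w.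
Proof. exact: ComplexField.Normc.normcM. Qed.

Lemma cabs1 : cabs (1 : R[i]) = 1.
Proof. exact: ComplexField.Normc.normc1. Qed.

Lemma cabsV z : cabs z^-1 = (cabs z)^-1.
Proof. exact: ComplexField.Normc.normcV. Qed.

Lemma cabsX z n : cabs (z ^+ n) = cabs z ^+ n.
Proof.
by elim: n => [|n ih]; rewrite ?expr0 ?cabs1// !exprS cabsM ih.
Qed.

Lemma cabsN z : cabs (- z) = cabs z.
Proof. exact: (@normcN R z). Qed.

Lemma cabs_distC z w : cabs (z - w) = cabs (w - z).
Proof. by rewrite -cabsN opprB. Qed.

Lemma le_cabsD z w : cabs (z + w) <= cabs z + cabs w.
Proof. exact: (@le_normcD R z w). Qed.

Lemma le_cabsB z w : cabs z - cabs w <= cabs (z - w).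
Proof. by rewrite lerBlDr -{1}(subrK w z) le_cabsD. Qed.

Lemma cabs_sum (I : Type) (r : seq I) (P : pred I) (F : I -> R[i]) :
  cabs (\sum_(i <- r | P i) F i) <= \sum_(i <- r | P i) cabs (F i).
Proof.
elim/big_rec2: _ => [|i x y _ ih]; first by rewrite cabs0.
by apply: le_trans (le_cabsD _ _) _; rewrite lerD2l.
Qed.

Lemma cabsJ z : cabs (z^*)%C = cabs z.
Proof. by case: z => a b; rewrite !cabsE /= sqrrN. Qed.

Lemma cabs_real (x : R) : cabs x%:C%C = `|x|.
Proof. by rewrite cabsE /= expr0n addr0 sqrtr_sqr. Qed.

Lemma normRe_le_cabs z : `|complex.Re z| <= cabs z.
Proof. by rewrite cabsE -sqrtr_sqr ler_wsqrtr// lerDl sqr_ge0. Qed.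

Lemma normIm_le_cabs z : `|complex.Im z| <= cabs z.
Proof. by rewrite cabsE -sqrtr_sqr ler_wsqrtr// lerDr sqr_ge0. Qed.

Lemma ReD z w : complex.Re (z + w) = complex.Re z + complex.Re w.
Proof. by case: z; case: w. Qed.

Lemma ReN z : complex.Re (- z) = - complex.Re z.
Proof. by case: z. Qed.

Lemma ReM_real (a : R) z : complex.Re (a%:C%C * z) = a * complex.Re z.
Proof. by case: z => x y /=; rewrite mul0r subr0. Qed.

Lemma Re_sum (I : Type) (r : seq I) (P : pred I) (F : I -> R[i]) :
  complex.Re (\sum_(i <- r | P i) F i) = \sum_(i <- r | P i) complex.Re (F i).
Proof. by apply: (big_morph (@complex.Re R) ReD). Qed.

Lemma ImD z w : complex.Im (z + w) = complex.Im z + complex.Im w.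
Proof. by case: z; case: w. Qed.

Lemma Im_sum (I : Type) (r : seq I) (P : pred I) (F : I -> R[i]) :
  complex.Im (\sum_(i <- r | P i) F i) = \sum_(i <- r | P i) complex.Im (F i).
Proof. by apply: (big_morph (@complex.Im R) ImD). Qed.

Lemma cabs_subX (rho : R) z w n : cabs z <= rho -> cabs w <= rho ->
  cabs (z ^+ n.+1 - w ^+ n.+1) <= n.+1%:R * rho ^+ n * cabs (z - w).
Proof.
move=> hz hw; rewrite subrXX cabsM mulrC.  apply: ler_wpM2r; first exact: cabs_ge0. 
apply: le_trans (cabs_sum _ _ _) _.
rewrite mulr_natl -[X in rho ^+ n *+ X](card_ord n.+1) -sumr_const.
apply: ler_sum => i _; rewrite cabsM !cabsX /=.
have ->: rho ^+ n = rho ^+ (n - i) * rho ^+ i.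
  by rewrite -exprD subnK// -ltnS.
by rewrite ler_pM// ?exprn_ge0 ?cabs_ge0// lerXn2r// ?nnegrE ?(le_trans (cabs_ge0 _) hz)// cabs_ge0.
Qed.

End ComplexModulus.

Section LogRemainder.
Context {R : realType}.

(** Differentiation is over the reals, hence componentwise; both components go through a single
    induction because the product rule mixes them. *)
Lemma is_derive_segX (a c : R[i]) (n : nat) (t : R) :
  let q s : R[i] := a + s%:C%C * c in
  is_derive t 1 (fun s => complex.Re (q s ^+ n.+1))
    (n.+1%:R * complex.Re (c * q t ^+ n)) /\
  is_derive t 1 (fun s => complex.Im (q s ^+ n.+1))
    (n.+1%:R * complex.Im (c * q t ^+ n)).
Proof.
move=> q.
have affine (x y : R) : is_derive t 1 (fun s => x + s * y) y.
  apply: is_derive_eq (is_deriveD (is_derive_cst x t 1)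
    (is_deriveM (is_derive_id t 1) (is_derive_cst y t 1))) _.
  by rewrite scaler0 !add0r; exact: mulr1.
have dRe : is_derive t 1 (fun s => complex.Re (q s)) (complex.Re c).
  rewrite (_ : (fun s => _) = fun s => complex.Re a + s * complex.Re c)//.
  by apply/funext => s; rewrite ReD ReM_real.
have dIm : is_derive t 1 (fun s => complex.Im (q s)) (complex.Im c).
  rewrite (_ : (fun s => _) = fun s => complex.Im a + s * complex.Im c)//.
  by apply/funext => s; rewrite ImD; case: (c) => u v /=; rewrite mul0r addr0.
elim: n => [|n [ihr ihi]].
  by split; rewrite expr0 mulr1 mul1r.
have ReM (z w : R[i]) : complex.Re (z * w) = complex.Re z * complex.Re w - complex.Im z * complex.Im w.
  by case: z; case: w.
have ImM (z w : R[i]) : complex.Im (z * w) = complex.Re z * complex.Im w + complex.Im z * complex.Re w.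
  by case: z; case: w.
split.
- rewrite (_ : (fun s => _) = ((fun s => complex.Re (q s)) * (fun s => complex.Re (q s ^+ n.+1))
     - (fun s => complex.Im (q s)) * (fun s => complex.Im (q s ^+ n.+1)))); last first.
    by apply/funext => s; rewrite [in LHS]exprS ReM.
  apply: is_derive_eq (is_deriveB (is_deriveM dRe ihr) (is_deriveM dIm ihi)) _.
  rewrite /GRing.scale/=.
  rewrite !exprS ?(ReM, ImM) [in RHS]mulrS.
  move: (complex.Re (q t)) (complex.Im (q t)) (complex.Re (q t ^+ n)) (complex.Im (q t ^+ n)).
  move: (n.+1%:R : R) (complex.Re c) (complex.Im c) => k p r x y X Y.
  ring.
- rewrite (_ : (fun s => _) = ((fun s => complex.Re (q s)) * (fun s => complex.Im (q s ^+ n.+1))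
     + (fun s => complex.Im (q s)) * (fun s => complex.Re (q s ^+ n.+1)))); last first.
    by apply/funext => s; rewrite [in LHS]exprS ImM.
  apply: is_derive_eq (is_deriveD (is_deriveM dRe ihi) (is_deriveM dIm ihr)) _.
  rewrite /GRing.scale/=.
  rewrite !exprS ?(ReM, ImM) [in RHS]mulrS.
  move: (complex.Re (q t)) (complex.Im (q t)) (complex.Re (q t ^+ n)) (complex.Im (q t ^+ n)).
  move: (n.+1%:R : R) (complex.Re c) (complex.Im c) => k p r x y X Y.
  ring.
Qed.

Lemma is_derive_ln_sum_sqr (f g : R -> R) (t f' g' : R) :
  is_derive t 1 f f' -> is_derive t 1 g g' -> 0 < f t ^+ 2 + g t ^+ 2 ->
  is_derive t 1 (fun s => ln (f s ^+ 2 + g s ^+ 2))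
    (2 * (f t * f' + g t * g') / (f t ^+ 2 + g t ^+ 2)).
Proof.
move=> df dg h.
have dP := is_deriveD (is_deriveX 2 df) (is_deriveX 2 dg).
have h' : 0 < (f ^+ 2 + g ^+ 2) t by [].
have := is_derive1_comp (is_derive1_ln h') dP.
rewrite (_ : _ \o _ = fun s => ln (f s ^+ 2 + g s ^+ 2))// => dl.
apply: is_derive_eq dl _.
rewrite mulrC; congr (_ * _); rewrite /GRing.scale/= !expr1.
by rewrite mulrDr !mulrA.
Qed.

Lemma is_derive_ln_cabs (a c : R[i]) (t : R) :
  let q s : R[i] := a + s%:C%C * c in
  q t != 1 ->
  is_derive t 1 (fun s => ln (cabs (1 - q s))) (- complex.Re (c / (1 - q t))).
Proof.
move=> q qt1.
pose f s := complex.Re (1 - q s); pose g s := complex.Im (1 - q s).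
have PE s : f s ^+ 2 + g s ^+ 2 = cabs (1 - q s) ^+ 2 by rewrite sqr_cabs.
have Pt0 : 0 < f t ^+ 2 + g t ^+ 2.
  by rewrite PE exprn_gt0// lt_neqAle cabs_ge0 eq_sym cabs_eq0 subr_eq0 eq_sym qt1.
have qE s : 1 - q s = (1 - a) + s%:C%C * (- c) by rewrite /q; ring.
have [df dg] : is_derive t 1 f (- complex.Re c) /\ is_derive t 1 g (- complex.Im c).
  have [] := is_derive_segX (1 - a) (- c) 0 t; rewrite !expr0 !mulr1 !mul1r.
  under eq_fun do rewrite expr1 -qE.
  move=> h; under eq_fun do rewrite expr1 -qE.
  by case: (c) h => x y /= h1 h2.
have dln := is_deriveZ 2^-1 (is_derive_ln_sum_sqr df dg Pt0).
have -> : (fun s => ln (cabs (1 - q s))) = 2^-1 \*: (fun s => ln (f s ^+ 2 + g s ^+ 2)).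
  apply/funext => s /=; rewrite PE /GRing.scale/=.
  (* The two functions must agree everywhere; where the modulus vanishes, both sides are 0 because
     [ln] is 0 there. *)
  have [->|h] := eqVneq (cabs (1 - q s)) 0.
    by rewrite expr0n/= (ln0 (lexx _)) mulr0.
  by rewrite lnXn ?lt_neqAle 1?eq_sym ?h ?cabs_ge0// -(mulr_natl (ln _)) mulKf// pnatr_eq0.
apply: is_derive_eq dln _.
rewrite /GRing.scale/=.
have -> : complex.Re (c / (1 - q t)) =
   (complex.Re c * f t + complex.Im c * g t) / (f t ^+ 2 + g t ^+ 2).
  rewrite /f /g; case: (c) => x y; case: (1 - q t) => u v /=.
  by rewrite mulrN opprK mulrDl !mulrA.
by rewrite -(mulrA 2) mulKf ?pnatr_eq0// -mulNr; congr (_ / _); ring.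
Qed.

(** Trades the denominator (x - y) x^m, which the bound on |q|^m / |1 - q| produces, for the
    difference of powers in [Ubar_], at the cost of a factor m + 1. *)
Lemma subX_le_mul (x y : R) (m : nat) : 0 <= y -> y <= x ->
  x ^+ m.+1 - y ^+ m.+1 <= m.+1%:R * ((x - y) * x ^+ m).
Proof.
move=> y0 yx; have x0 := le_trans y0 yx.
rewrite subrXX mulrCA ler_wpM2l ?subr_ge0//.
rewrite mulr_natl -[X in _ *+ X](card_ord m.+1) -sumr_const.
apply: ler_sum => i _ /=.
have -> : x ^+ m = x ^+ (m - i) * x ^+ i by rewrite -exprD subnK// -ltnS.
by rewrite ler_wpM2l ?exprn_ge0// lerXn2r.
Qed.

(** Division by u leaves q running from v/u to z/u, with velocity c = (z - v)/u. In the derivative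
    of ln|1 - q| plus the first m terms, the geometric sum cancels everything except -Re(c q^m / (1
    - q)). The mean value theorem then concludes, with no infinite series to sum. *)
Lemma log_remainder_le (u z v : R[i]) (rho : R) (m : nat) :
  cabs z <= rho -> cabs v <= rho -> rho < cabs u ->
  `|ln (cabs (z - u)) - ln (cabs (v - u))
    + \sum_(j < m) j.+1%:R^-1 *
        complex.Re ((z ^+ j.+1 - v ^+ j.+1) / u ^+ j.+1)|
  <= cabs (z - v) * (m.+1%:R * rho ^+ m / (cabs u ^+ m.+1 - rho ^+ m.+1)).
Proof.
move=> hz hv hu.
have rho0 : 0 <= rho by exact: le_trans (cabs_ge0 _) hz.
have cu0 : 0 < cabs u by exact: le_lt_trans hu.
have u0 : u != 0 by rewrite -cabs_eq0 gt_eqF.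
pose a := v / u; pose c := (z - v) / u.
pose q s : R[i] := a + s%:C%C * c.
have qE s : q s = (v + s%:C%C * (z - v)) / u by rewrite /q /a /c; field.
have q0 : q 0 = v / u by rewrite qE mul0r addr0.
have q1 : q 1 = z / u by rewrite qE mul1r subrKC.
have hq (s : R) : s \in `]0, 1[ -> cabs (q s) <= rho / cabs u.
  rewrite in_itv/= => /andP[s0 s1]; rewrite qE cabsM cabsV ler_wpM2r ?invr_ge0 ?cabs_ge0//.
  have -> : v + s%:C%C * (z - v) = (1 - s)%:C%C * v + s%:C%C * z.
    by rewrite rmorphB rmorph1; ring.
  apply: le_trans (le_cabsD _ _) _; rewrite !cabsM !cabs_real.
  rewrite (ger0_norm (ltW s0)) ger0_norm ?subr_ge0 ?(ltW s1)//.
  have h1 : (1 - s) * cabs v <= (1 - s) * rho by rewrite ler_wpM2l// subr_ge0 ltW.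
  have h2 : s * cabs z <= s * rho by rewrite ler_wpM2l// ltW.
  lra.
(* By convexity the segment stays in a disc of radius below 1, so 1 - q never vanishes. *)
have theta1 : rho / cabs u < 1 by rewrite ltr_pdivrMr// mul1r.
have q_neq1 s : cabs (q s) <= rho / cabs u -> q s != 1.
  by move=> h; apply: contraTneq theta1 => e; rewrite -leNgt -cabs1 -e.
have hq0 : cabs (q 0) <= rho / cabs u.
  by rewrite q0 cabsM cabsV ler_wpM2r ?invr_ge0 ?cabs_ge0.
have hq1 : cabs (q 1) <= rho / cabs u.
  by rewrite q1 cabsM cabsV ler_wpM2r ?invr_ge0 ?cabs_ge0.
have hq' (s : R) : s \in `[0, 1] -> cabs (q s) <= rho / cabs u.
  have [->//|s0] := eqVneq s 0; have [->//|s1] := eqVneq s 1.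
  rewrite in_itv/= => /andP[h0 h1]; apply: hq.
  by rewrite in_itv/= !lt_neqAle h0 h1 eq_sym s0 s1.
pose F := (fun s => ln (cabs (1 - q s))) +
  \sum_(j < m) (j.+1%:R^-1 : R) *: (fun s => complex.Re (q s ^+ j.+1)).
have dF (s : R) : s \in `[0, 1] ->
    is_derive s 1 F (- complex.Re (c * q s ^+ m / (1 - q s))).
  move=> /hq'/q_neq1 hs.
  have d1 := is_derive_ln_cabs hs.
  have d2 (j : 'I_m) := is_deriveZ (j.+1%:R^-1) (is_derive_segX a c j s).1.
  apply: is_derive_eq (is_deriveD d1 (is_derive_sum d2)) _.
  rewrite -/(q s).
  under eq_bigr do rewrite /GRing.scale/= mulrA mulVf// mul1r.
  rewrite -Re_sum -mulr_sumr.
  have s1 : 1 - q s != 0 by rewrite subr_eq0 eq_sym.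
  have gs : \sum_(j < m) q s ^+ j = (1 - q s ^+ m) / (1 - q s).
    apply: (mulIf s1); rewrite divfK// mulrC.
    by rewrite -[LHS]opprK -mulNr opprB -subrX1 opprB.
  by rewrite gs -!ReN -ReD; congr complex.Re; field.
have dc : {within `[0, 1], continuous F}.
  by apply: derivable_within_continuous => s /dF[].
have [s s01 Fs] := MVT ltr01 (fun s s01 => dF s (subset_itv_oo_cc s01)) dc.
have FE s' : F s' = ln (cabs (1 - q s'))
    + \sum_(j < m) j.+1%:R^-1 * complex.Re (q s' ^+ j.+1).
  by rewrite /F fctE fct_sumE.
have lnq (w : R[i]) : cabs w <= rho ->
    ln (cabs (1 - w / u)) = ln (cabs (w - u)) - ln (cabs u).
  move=> hw; have wu : 0 < cabs (w - u).
    rewrite cabs_distC; apply: lt_le_trans (le_cabsB _ _).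
    by rewrite subr_gt0 (le_lt_trans hw).
  have -> : 1 - w / u = (u - w) / u by rewrite mulrBl divff.
  by rewrite cabsM cabsV cabs_distC ln_div ?posrE.
have -> : ln (cabs (z - u)) - ln (cabs (v - u))
    + \sum_(j < m) j.+1%:R^-1 *
        complex.Re ((z ^+ j.+1 - v ^+ j.+1) / u ^+ j.+1) = F 1 - F 0.
  rewrite !FE q0 q1 !lnq// opprD addrACA -sumrB.
  congr (_ + _); first by rewrite opprB addrA subrK.
  apply: eq_bigr => j _; rewrite -mulrBr -ReN -ReD !expr_div_n -mulrBl//.
rewrite Fs subr0 mulr1 normrN.
apply: le_trans (normRe_le_cabs _) _.
rewrite !cabsM !cabsV cabsX.
have qs := hq _ s01.
have s1 : 1 - rho / cabs u <= cabs (1 - q s).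
  by apply: le_trans (le_cabsB _ _); rewrite cabs1 lerD2l lerN2.
have p1 : 0 < 1 - rho / cabs u by rewrite subr_gt0.
apply: (@le_trans _ _ (cabs (z - v) / cabs u * (rho / cabs u) ^+ m / (1 - rho / cabs u))).
  apply: ler_pM; rewrite ?invr_ge0 ?mulr_ge0 ?invr_ge0 ?exprn_ge0 ?cabs_ge0//.
    rewrite ler_wpM2l ?divr_ge0 ?cabs_ge0// lerXn2r ?nnegrE ?cabs_ge0//.
    by rewrite divr_ge0// ltW.
  by rewrite lef_pV2 ?posrE// (lt_le_trans p1).
have -> : cabs (z - v) / cabs u * (rho / cabs u) ^+ m / (1 - rho / cabs u) =
   cabs (z - v) * (rho ^+ m / ((cabs u - rho) * cabs u ^+ m)).
  rewrite expr_div_n; field.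
  by rewrite expf_neq0 ?gt_eqF ?subr_gt0.
rewrite ler_wpM2l ?cabs_ge0// -mulrA (mulrC m.+1%:R) -!mulrA ler_wpM2l ?exprn_ge0//.
have h1 : 0 < (cabs u - rho) * cabs u ^+ m by rewrite mulr_gt0 ?subr_gt0 ?exprn_gt0.
have h2 : 0 < cabs u ^+ m.+1 - rho ^+ m.+1 by rewrite subr_gt0 ltrXn2r// ?nnegrE ltW.
rewrite mulrC ler_pdivlMr// mulrC ler_pdivrMr//.
exact: subX_le_mul (ltW hu).
Qed.


End LogRemainder.

Section LogSum.
Context {R : realType}.

(** For the orders up to m the modulus is taken after summing over the points, which keeps the
    cancellations that [U_] measures; only the remainder is summed in absolute value. *)
Lemma sum_log_le (I : eqType) (s : seq I) (u : I -> R[i]) (z v : R[i])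
    (rho k : R) (m : nat) :
  cabs z <= rho -> cabs v <= rho -> (forall i, i \in s -> rho < cabs (u i)) ->
  (forall j, (j < m)%N -> cabs (\sum_(i <- s) 1 / (u i)^*%C ^+ j.+1) <= k) ->
  \sum_(i <- s) (cabs (u i) ^+ m.+1 - rho ^+ m.+1)^-1 <= k ->
  `|\sum_(i <- s) (ln (cabs (z - u i)) - ln (cabs (v - u i)))|
  <= cabs (z - v) * k * (\sum_(j < m) rho ^+ j + m.+1%:R * rho ^+ m).
Proof.
move=> hz hv hu hU hUbar.
have rho0 : 0 <= rho by exact: le_trans (cabs_ge0 _) hz.
pose T i : R := \sum_(j < m) j.+1%:R^-1 *
  complex.Re ((z ^+ j.+1 - v ^+ j.+1) / u i ^+ j.+1).
have -> : \sum_(i <- s) (ln (cabs (z - u i)) - ln (cabs (v - u i))) =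
   \sum_(i <- s) (ln (cabs (z - u i)) - ln (cabs (v - u i)) + T i) - \sum_(i <- s) T i.
  by rewrite [X in _ = X - _]big_split addrK.
apply: le_trans (ler_normB _ _) _; rewrite addrC mulrDr; apply: lerD.
- rewrite /T exchange_big/=; apply: le_trans (ler_norm_sum _ _ _) _.
  rewrite mulr_sumr; apply: ler_sum => j _.
  rewrite -mulr_sumr -Re_sum -mulr_sumr normrM normfV normr_nat mulrC ler_pdivrMr//.
  apply: le_trans (normRe_le_cabs _) _; rewrite cabsM.
  (* Conjugation commutes with the sum and preserves the modulus, so the conjugate in [U_] does no
     harm. Afterwards the factor j + 1 of [cabs_subX] cancels the 1/(j + 1) of the series. *)
  have -> : cabs (\sum_(i <- s) (u i ^+ j.+1)^-1) = cabs (\sum_(i <- s) 1 / (u i)^*%C ^+ j.+1).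
    rewrite -[RHS]cabsJ rmorph_sum; congr cabs; apply: eq_bigr => i _.
    by rewrite div1r -[in RHS]rmorphXn -fmorphV [RHS]conjcK.
  apply: (@le_trans _ _ (j.+1%:R * rho ^+ j * cabs (z - v) * k)).
    by rewrite ler_pM ?cabs_ge0 ?cabs_subX// hU.
  by rewrite le_eqVlt; apply/orP; left; apply/eqP; ring.
- apply: le_trans (ler_norm_sum _ _ _) _.
  apply: (@le_trans _ _ (\sum_(i <- s) cabs (z - v) * (m.+1%:R * rho ^+ m) *
      (cabs (u i) ^+ m.+1 - rho ^+ m.+1)^-1)).
    rewrite big_seq [leRHS]big_seq; apply: ler_sum => i /hu ui.
    by rewrite -mulrA; exact: log_remainder_le.
  rewrite -mulr_sumr -[leLHS]mulrA -[leRHS]mulrA ler_wpM2l ?cabs_ge0//.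
  by rewrite [leRHS]mulrC ler_wpM2l// mulr_ge0// exprn_ge0.
Qed.

End LogSum.

(** * Labels of a configuration *)

Section Labels.
Context {R : realType} {d : nat} {S : set 'rV[R]_d}.
Implicit Types (y : config S) (A K : set 'rV[R]_d).

Lemma labels_S y i : (labels y).1 i -> S ((labels y).2 i).
Proof. by rewrite /labels; case: cid => L /= [] + _; exact. Qed.

Lemma config_measureE y (A : set (borel_space R d)) :
  y A = (\esum_(i in (labels y).1) \d_((labels y).2 i : borel_space R d) A)%E.
Proof. by rewrite /labels; case: cid => L /= []. Qed.

Lemma config_measure_card y A :
  y A = (\esum_(i in labels_in y A) 1%E)%E.
Proof.
rewrite config_measureE [RHS]esum_mkcond [LHS]esum_mkcond.
apply: eq_esum => i _; rewrite diracE.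
have [Ii|Ii] := boolP (i \in (labels y).1); have [Ai|Ai] := boolP ((labels y).2 i \in A).
- by rewrite mem_set//; move: Ii Ai; rewrite !inE => Ii Ai; split.
- by rewrite memNset// => -[_ /mem_set]; rewrite (negbTE Ai).
- by rewrite memNset// => -[/mem_set]; rewrite (negbTE Ii).
- by rewrite memNset// => -[/mem_set]; rewrite (negbTE Ii).
Qed.

Lemma finite_labels_in y A : (y A < +oo)%E -> finite_set (labels_in y A).
Proof.
move=> yAoo; apply: contrapT => infA.
have yAfin : y A \is a fin_num by rewrite ge0_fin_numE.
have [B BA nB] := infinite_set_fset (Num.truncn (fine (y A))).+1 infA.
have : (\sum_(i \in [set` B]) (1 : R)%:E <= y A)%E.
  by rewrite config_measure_card; apply: esum_ge; exists [set` B].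
rewrite fsbig_finite//= set_fsetK sumEFin big_const_seq count_predT iter_addr addr0.
rewrite -(fineK yAfin) lee_fin leNgt => /negP; apply.
apply: lt_le_trans (truncnS_gt _) _.
by rewrite ler_nat.
Qed.

Lemma finite_labels_bounded y A (M : R) :
  (forall x, A x -> `|x| <= M) -> finite_set (labels_in y A).
Proof.
(* The maximum with 1 makes the radius positive, as [closed_ballE] asks. *)
move=> AM; pose K := closed_ball (0 : 'rV[R]_d) (Num.max M 1).
have M0 : 0 < Num.max M 1 by rewrite lt_max ltr01 orbT.
have cK : compact K.
  apply: bounded_closed_compact; last exact: closed_ball_closed.
  exists (Num.max M 1); split; first exact: num_real.
  move=> r Mr x; rewrite /K closed_ballE// /closed_ball_/= sub0r normrN => xM.
  exact: le_trans xM (ltW Mr).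
apply: sub_finite_set (finite_labels_in (config_locally_finite y cK)).
move=> i [Ii Ai]; split=> //; rewrite /K closed_ballE// /closed_ball_/= sub0r normrN.
by rewrite le_max AM.
Qed.

Lemma psumE (V : nmodType) y A (F : 'rV[R]_d -> V) : finite_set (labels_in y A) ->
  psum y A F = \sum_(i <- fset_set (labels_in y A)) F ((labels y).2 i).
Proof. by move=> fA; rewrite /psum fsbig_finite. Qed.

(** Finiteness is asked only of the labels where F is nonzero. This covers both a compactly
    supported F on the whole space and an arbitrary F on a bounded set. *)
Lemma pesum_psum y A (F : 'rV[R]_d -> R) :
  finite_set [set i | labels_in y A i /\ F ((labels y).2 i) <> 0] ->
  (forall x, A x -> 0 <= F x) ->
  pesum y A (fun x => (F x)%:E) = (psum y A F)%:E.
Proof.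
move=> fA F0; set B := [set i | _] in fA.
have BA : B = labels_in y A `&` B by apply/seteqP; split=> [i Bi|i []//]; split=> //; case: Bi.
rewrite /pesum (@esumID _ _ B).
  rewrite -BA esum_fset//; last first.
    by move=> i; rewrite inE => -[[_ Ai] _]; rewrite lee_fin F0.
  rewrite [X in (_ + X)%E]esum1 ?adde0; last first.
    move=> i [[Ii Ai] nB]; congr EFin.
    by apply: contrapT => h; apply: nB; split.
  rewrite fsumEFin// /psum; congr EFin.
  rewrite [LHS](fsbig_widen B (labels_in y A))// => [i []//|i [Ai nB] /=].
  by apply: contrapT => h; apply: nB.
by move=> i [_ Ai]; rewrite lee_fin F0.
Qed.

End Labels.

(** * Vague lower semicontinuity of the counts *)

Section Bump.
Context {R : realType} {d : nat}.

(** The maximum of one tent function per point, each supported in a closed ball inside U. *)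
Lemma bump_seq (U : set 'rV[R]_d) (s : seq 'rV[R]_d) :
  open U -> (forall p, p \in s -> U p) ->
  exists g : 'rV[R]_d -> R, [/\ continuous g, forall x, 0 <= g x <= 1,
    forall p, p \in s -> g p = 1 &
    exists2 K, compact K & K `<=` U /\ forall x, ~ K x -> g x = 0].
Proof.
move=> oU; elim: s => [|p s ih] sU.
  exists (cst 0); split => //; first exact: cst_continuous.
  - by move=> x; rewrite lexx ler01.
  - exists set0; [exact: compact0 | by split].
have [|g [cg g01 g1 [K cK [KU g0]]]] := ih.
  by move=> q qs; apply: sU; rewrite in_cons qs orbT.
have /nbhs_closedballP[e eU] : nbhs p U.
  by apply: open_nbhs_nbhs; split=> //; apply: sU; rewrite in_cons eqxx.
pose h (x : 'rV[R]_d) : R := Num.max 0 (1 - e%:num^-1 * `|x - p|).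
have ch : continuous h.
  move=> x; refine (@continuous_max R _ (cst 0) (fun x : 'rV[R]_d => 1 - e%:num^-1 * `|x - p|) x _ _).
    exact: cst_continuous.
  apply: (@continuousB R R^o 'rV[R]_d (cst (1 : R)) (fun x : 'rV[R]_d => e%:num^-1 * `|x - p|)).
    exact: cst_continuous.
  apply: (@continuousM R 'rV[R]_d (cst (e%:num^-1 : R)) (fun x : 'rV[R]_d => `|x - p|)).
    exact: cst_continuous.
  apply: (@continuous_comp 'rV[R]_d 'rV[R]_d R (fun x => x - p) (fun x => `|x|)).
    by apply: continuousB; [exact: cvg_id|exact: cst_continuous].
  exact: norm_continuous.
exists (fun x => Num.max (g x) (h x)); split.
- by move=> x; exact: (@continuous_max R _ g h x (cg x) (ch x)).
- move=> x; have /andP[a b] := g01 x; rewrite le_max a/= ge_max b/=.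
  by rewrite /h ge_max ler01/= gerBl mulr_ge0.
- move=> q; rewrite in_cons => /predU1P[->|/g1 ->].
    rewrite /h subrr normr0 mulr0 subr0.
    by rewrite [X in Num.max _ X]max_r// max_r//; case/andP: (g01 p).
  by rewrite max_l// /h ge_max ler01 gerBl mulr_ge0.
- exists (K `|` closed_ball p e%:num).
    apply: compactU => //; apply: bounded_closed_compact; last exact: closed_ball_closed.
    exists (`|p| + e%:num); split; first exact: num_real.
    move=> r pr x; rewrite closed_ballE// /closed_ball_/= => xp.
    apply: le_trans (ltW pr).
    by rewrite -[X in `|X|](subrK p) addrC (le_trans (ler_normD _ _))// lerD2l distrC.
  split; first by rewrite subUset; split.
  move=> x /not_orP[nK nB]; rewrite g0//; apply/max_l.
  rewrite /h ge_max lexx/= subr_le0.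
  have : e%:num < `|x - p|.
    by rewrite ltNge; apply/negP => xp; apply: nB; rewrite closed_ballE// /closed_ball_/= distrC.
  by move=> /ltW; rewrite mulrC ler_pdivlMr// mul1r.
Qed.

End Bump.

Section ConfigMeasurable.
Context {R : realType} {d : nat} {S : set 'rV[R]_d}.

Lemma Cc_finite_labels (y : config S) (g : 'rV[R]_d -> R) : Cc S g ->
  finite_set [set i | labels_in y setT i /\ g ((labels y).2 i) <> 0].
Proof.
move=> [_ [K cK g0]].
apply: sub_finite_set (finite_labels_in (config_locally_finite y cK)).
move=> i [[Ii _] gi]; split => //; apply: contrapT => nK; apply: gi.
by apply: g0 => //; exact: labels_S.
Qed.

Lemma open_psum_gt (g : 'rV[R]_d -> R) (a : R) : Cc S g ->
  open [set y : vague_config S | a < psum (y : config S) setT g].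
Proof.
move=> cg.
pose Tc (f : {f : 'rV[R]_d -> R | Cc S f}) := Topological.class
  (initial_topology (fun s : config S => psum s setT (sval f) : R)).
suff cpsum : continuous (fun y : vague_config S => psum (y : config S) setT g : R).
  by move/continuousP : cpsum => /(_ _ (@open_gt R a)).
move=> y B nB.
have [+ _] := @cvg_sup (config S) _ Tc (nbhs (y : vague_config S)) y _.
(* The neighbourhood filter of y converges to y in the supremum topology, hence in each initial
   topology of which it is the supremum. *)
move=> /(_ (fun _ => id)) /(_ (exist _ g cg)) H.
apply: H.
exact: (@initial_continuous (config S) R (fun s : config S => psum s setT g) y B nB).
Qed.

(** If y has mass above a in U, finitely many of its points already do. A bump g equal to 1 at those
    lying in U and supported in U has a vaguely continuous sum, which exceeds a at y and is at most
    the mass of U everywhere. *)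
Lemma open_measure_gt (U : set 'rV[R]_d) (a : R) : open U ->
  open [set y : vague_config S | (a%:E < (y : config S) U)%E].
Proof.
move=> oU; rewrite openE => y /= ay.
move: ay; rewrite config_measureE => /ereal_sup_gt[_ [F [fF FI] <-] aF].
have [|g [cg g01 g1 [K cK [KU gK]]]] := @bump_seq R d U
  [seq (labels y).2 i | i <- fset_set F & (labels y).2 i \in U] oU.
  move=> p pp; have [i +] := elimT mapP pp; rewrite mem_filter => /andP[/set_mem Ui _] ->; exact: Ui.
have Ccg : Cc S g.
  split; first exact: continuous_subspaceT.
  by exists K => // x _; exact: gK.
have g0 x : 0 <= g x by case/andP: (g01 x).
have gU x : g x <= (x \in U)%:R.
  have [xU|xU] := boolP (x \in U); first by case/andP: (g01 x).
  rewrite gK// => /KU /mem_set; by rewrite (negbTE xU).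
have pg (y' : config S) : ((psum y' setT g)%:E = pesum y' setT (fun x => (g x)%:E))%E.
  by rewrite pesum_psum//; exact: Cc_finite_labels.
have le_g (y' : config S) : ((psum y' setT g)%:E <= y' U)%E.
  rewrite pg config_measureE /pesum (_ : labels_in y' setT = (labels y').1).
    by apply: le_esum => i _; rewrite diracE lee_fin; exact: gU.
  by apply/seteqP; split=> [i []|i Ii]; [|split].
apply: filterS (open_nbhs_nbhs (conj (open_psum_gt a Ccg) _)) => [y' /= ay'|/=].
  by apply: lt_le_trans (le_g y'); rewrite lte_fin.
rewrite -lte_fin pg; apply: lt_le_trans aF _.
apply: (@le_trans _ _ (\sum_(i \in F) (g ((labels y).2 i))%:E)%E).
  apply: lee_fsum => // i Fi; rewrite diracE lee_fin.
  have [xU|xU] := boolP ((labels y).2 i \in U); last exact: g0.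
  rewrite g1//; apply/mapP; exists i => //.
  by rewrite mem_filter xU in_fset_set// mem_set.
by apply: esum_ge; exists F => //; split=> // i /FI Ii; split.
Qed.

End ConfigMeasurable.

(** * Measurability of sums over points *)

Section MeasurableCounts.
Context {R : realType} {d : nat} {S : set 'rV[R]_d}.

Lemma open_borel (U : set 'rV[R]_d) : open U -> measurable (U : set (borel_space R d)).
Proof. exact: sub_sigma_algebra. Qed.

Definition mass (A : set (borel_space R d)) (y : config_space S) : \bar R :=
  (y : config S) A.

Lemma measurable_measure_open (U : set 'rV[R]_d) : open U ->
  measurable_fun setT (mass U).
Proof.
move=> oU; apply: (measurability _ (ErealGenOInfty.measurableE R)).
move=> /= _ [_ [a ->]] <-; apply: measurableI => //.
by rewrite preimage_itvoy; apply: sub_sigma_algebra; exact: open_measure_gt.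
Qed.

Let B (n : nat) : set (borel_space R d) := ball (0 : 'rV[R]_d) n.+1%:R.

Let oB n : open (B n : set 'rV[R]_d).
Proof. exact: ball_open. Qed.

Let mB n : measurable (B n).
Proof. exact: open_borel. Qed.

Let B_fin (y : config S) n : (y (B n) < +oo)%E.
Proof.
rewrite config_measure_card esum_fset//; last first.
  apply: (@finite_labels_bounded _ _ _ _ _ n.+1%:R) => x.
  by rewrite /B -ball_normE /ball_/= sub0r normrN => /ltW.
rewrite fsbig_finite/=; last first.
  apply: (@finite_labels_bounded _ _ _ _ _ n.+1%:R) => x.
  by rewrite /B -ball_normE /ball_/= sub0r normrN => /ltW.
by rewrite sumEFin ltry.
Qed.

(** Dynkin's argument, from the open sets to the Borel sets. The intersection with a ball keeps all
    masses finite, so that the step to complements is a genuine subtraction. *)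
Let measurable_measureI (A : set (borel_space R d)) n : measurable A ->
  measurable_fun setT (mass (A `&` B n)).
Proof.
move=> mA.
pose P (A : set (borel_space R d)) :=
  measurable_fun setT (mass (A `&` B n)).
apply: (@dynkin_induction _ (borel_space R d) (@open 'rV[R]_d) P) => //.
- by move=> U V; exact: openI.
- by rewrite /P setTI; exact: measurable_measure_open.
- by move=> U oU; apply: measurable_measure_open; exact: openI.
- move=> U mU PU.
  have fin (y : config S) V : measurable V -> (y (V `&` B n) < +oo)%E.
    move=> mV; apply: le_lt_trans (B_fin y n); apply: le_measure; rewrite ?inE//.
    exact: measurableI.
  have -> : P (~` U) = measurable_fun setT (mass (B n) \- mass (U `&` B n))%E.
    congr measurable_fun; apply/funext => y; rewrite /mass/=.
    rewrite setIC -setDE measureD//; last exact: B_fin.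
    by rewrite setIC.
  apply: emeasurable_funB => //; exact: measurable_measure_open.
- move=> F mF tF PF.
  have -> : P (\bigcup_k F k) = measurable_fun setT (fun y : config_space S =>
      \sum_(0 <= k <oo) mass (F k `&` B n) y)%E.
    congr measurable_fun; apply/funext => y; rewrite /mass/=.
    rewrite setI_bigcupl measure_bigcup//.
    + by apply: eq_eseriesl => k; rewrite in_setT.
    + by move=> k _; exact: measurableI.
    + exact: trivIset_setIr.
  by apply: ge0_emeasurable_sum => [k x _ _|k _]; [exact: measure_ge0|exact: PF].
Qed.

Lemma measurable_measure (A : set (borel_space R d)) : measurable A ->
  measurable_fun setT (mass A).
Proof.
move=> mA.
apply: (emeasurable_fun_cvg (fun n => mass (A `&` B n))).
  by move=> n; exact: measurable_measureI.
move=> y _.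
have AE : \bigcup_n (A `&` B n) = A.
  rewrite -setI_bigcupr; apply/setIidl => x _.
  exists (Num.truncn (`|x : 'rV[R]_d|)) => //.
  by rewrite /B -ball_normE /ball_/= sub0r normrN; exact: truncnS_gt.
rewrite /mass -[X in _ --> _ X]AE; apply: nondecreasing_cvg_mu.
- by move=> n; exact: measurableI.
- by apply: bigcup_measurable => n _; exact: measurableI.
- move=> m n mn; apply/subsetPset; apply: setIS => x.
  by apply: le_ball; rewrite ler_nat.
Qed.

(** Regarded as an integral against y, the sum is measurable in y by the theorem on integrals
    against kernels, once the masses of Borel sets are. The series of measures has a Dirac mass at
    each label in use and the zero measure elsewhere. *)
Lemma pesum_integral (y : config S) (F : borel_space R d -> \bar R) :
  (forall x, 0 <= F x)%E -> measurable_fun setT F ->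
  pesum y setT F = (\int[y]_x F x)%E.
Proof.
move=> F0 mF.
pose m n : {measure set (borel_space R d) -> \bar R} :=
  if n \in (labels y).1
  then (dirac ((labels y).2 n : borel_space R d) : {measure set (borel_space R d) -> \bar R})
  else (mzero : {measure set (borel_space R d) -> \bar R}).
have ym A : y A = mseries m 0 A.
  rewrite config_measureE esum_mkcond /mseries nneseries_esumT//.
  by apply: eq_esum => n _; rewrite /m; case: ifPn.
rewrite (eq_measure_integral (mseries m 0)) => [|A _ _]; last exact: ym.
rewrite ge0_integral_measure_series// nneseries_esumT; last first.
  by move=> *; exact: integral_ge0.
rewrite /pesum [LHS]esum_mkcond; apply: eq_esum => n _.
have -> : (n \in labels_in y setT) = (n \in (labels y).1).
  by apply/idP/idP => /set_mem h; apply/mem_set; [case: h|split].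
rewrite /m; case: ifPn => _.
  by rewrite integral_dirac// diracT mul1e.
by rewrite integral_measure_zero.
Qed.

Lemma measurable_pesumT (F : borel_space R d -> \bar R) :
  (forall x, 0 <= F x)%E -> measurable_fun setT F ->
  measurable_fun setT (fun y : config_space S => pesum (y : config S) setT F : \bar R).
Proof.
move=> F0 mF; under eq_fun do rewrite pesum_integral//.
apply: (@measurable_fun_integral_kernel _ _ (config_space S) (borel_space R d) R
  (fun y : config_space S => config_measure (y : config S)) _ F F0 mF).
by move=> U mU; exact: measurable_measure.
Qed.

Lemma pesum_restrict (y : config S) (A : set 'rV[R]_d) (F : 'rV[R]_d -> \bar R) :
  pesum y A F = pesum y setT (F \_ A).
Proof.
rewrite /pesum [LHS]esum_mkcond [RHS]esum_mkcond.
apply: eq_esum => i _; rewrite patchE.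
have [Ai|Ai] := boolP (i \in labels_in y A).
  have [Ii Aj] := set_mem Ai.
  by rewrite !mem_set//; split.
case: ifPn => // /set_mem[Ii _]; case: ifPn => // /set_mem Aj.
by case/negP: Ai; apply/mem_set; split.
Qed.

Lemma measurable_pesum (A : set (borel_space R d)) (F : borel_space R d -> \bar R) :
  measurable A -> (forall x, A x -> 0 <= F x)%E -> measurable_fun A F ->
  measurable_fun setT (fun y : config_space S => pesum (y : config S) A F : \bar R).
Proof.
move=> mA F0 mF; under eq_fun do rewrite pesum_restrict.
apply: measurable_pesumT; last exact: (measurable_restrictT F mA).1 mF.
by move=> x; rewrite patchE; case: ifPn => // /set_mem; exact: F0.
Qed.

(** On a bounded A all sums are finite, so the sums of the positive and the negative part can be
    subtracted. *)
Lemma measurable_psum (A : set (borel_space R d)) (M : R) (F : borel_space R d -> R) :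
  measurable A -> (forall x, A x -> `|x : 'rV[R]_d| <= M) -> measurable_fun A F ->
  measurable_fun setT (fun y : config_space S => psum (y : config S) A F : R).
Proof.
move=> mA AM mF.
have fin (y : config S) : finite_set (labels_in y A) by exact: (finite_labels_bounded y AM).
have mP (G : borel_space R d -> R) : (forall x, 0 <= G x) -> measurable_fun A G ->
    measurable_fun setT (fun y : config_space S => psum (y : config S) A G : R).
  move=> G0 mG.
  have h : measurable_fun setT (fun y : config_space S =>
     pesum (y : config S) A (fun x => (G x)%:E) : \bar R).
    apply: measurable_pesum => //; first by move=> x _; rewrite lee_fin.
    by apply: (measurableT_comp (@EFin_measurable R setT)).
  apply/measurable_EFinP; apply: eq_measurable_fun h => y _ /=.
  rewrite pesum_psum//; apply: sub_finite_set (fin y).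
  by move=> i [].
have -> : (fun y : config_space S => psum (y : config S) A F : R) =
    (fun y : config_space S => psum (y : config S) A (F^\+)%R) \-
    (fun y : config_space S => psum (y : config S) A (F^\-)%R).
  apply/funext => y /=; rewrite !psumE// -sumrB; apply: eq_bigr => i _.
  by rewrite -[in LHS](funrposBneg F).
apply: measurable_funB; apply: mP => //.
- exact: measurable_funrpos.
- exact: measurable_funrneg.
Qed.

End MeasurableCounts.

(** * Euclidean norm and measurability *)

Section Enorm.
Context {R : realType} {d : nat}.
Implicit Types x w : 'rV[R]_d.

Lemma enorm_ge0 x : 0 <= enorm x.
Proof. exact: sqrtr_ge0. Qed.

Lemma enorm0 : enorm (0 : 'rV[R]_d) = 0.
Proof. by rewrite /enorm big1 ?sqrtr0// => j _; rewrite mxE expr0n. Qed.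

Lemma coord_le_enorm x j : `|x 0 j| <= enorm x.
Proof.
rewrite -sqrtr_sqr ler_wsqrtr// (bigD1 j)//= lerDl sumr_ge0// => i _.
exact: sqr_ge0.
Qed.

Lemma enorm_eq0 x : (enorm x == 0) = (x == 0).
Proof.
apply/eqP/eqP => [x0|->]; last exact: enorm0.
apply/rowP => j; apply/eqP; rewrite mxE -normr_le0.
by rewrite -x0 coord_le_enorm.
Qed.

Lemma enormN x : enorm (- x) = enorm x.
Proof. by rewrite /enorm; under eq_bigr do rewrite mxE sqrrN. Qed.

Lemma mx_norm_le_enorm x : `|x| <= enorm x.
Proof.
rewrite [leLHS]/Num.norm/= mx_normrE; apply: bigmax_le; first exact: enorm_ge0.
by move=> [i j] _ /=; rewrite (ord1 i) coord_le_enorm.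
Qed.

Lemma continuous_enorm : continuous (@enorm R d).
Proof.
move=> x; apply: (@continuous_comp 'rV[R]_d R R (fun x => \sum_(j < d) x 0 j ^+ 2) Num.sqrt);
  last exact: sqrt_continuous.
apply: (@cvg_big R _ +%R 0 'I_d); [by move=> y; exact: add_continuous|exact: (nbhs_filter x)|].
move=> j _; rewrite expr2; under eq_fun do rewrite expr2.
by apply: (@continuousM R 'rV[R]_d (fun x => x 0 j) (fun x => x 0 j)); exact: coord_continuous.
Qed.

Lemma continuous_enormB w : continuous (fun x => enorm (x - w)).
Proof.
move=> x; apply: (@continuous_comp 'rV[R]_d 'rV[R]_d R (fun x => x - w) (@enorm R d));
  last exact: continuous_enorm.
by apply: continuousB; [exact: cvg_id|exact: cst_continuous].
Qed.

Lemma enorm_lipschitz_continuous (f : 'rV[R]_d -> R) (C : R) :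
  (forall x w, `|f x - f w| <= C * enorm (x - w)) -> continuous f.
Proof.
move=> fC w; apply/(@cvgrPdist_le _ _ _ _ (nbhs_filter w)) => e e0.
have : (fun x => C * enorm (x - w)) x @[x --> w] --> C * enorm (w - w).
  apply: (@continuousM R 'rV[R]_d (cst C) (fun x => enorm (x - w))).
    exact: cst_continuous.
  exact: continuous_enormB.
rewrite subrr enorm0 mulr0 => /(@cvgrPdist_le _ _ _ _ (nbhs_filter w)) /(_ e e0).
apply: filterS => x; rewrite sub0r normrN distrC => h.
by apply: le_trans (fC x w) _; apply: le_trans h; exact: ler_norm.
Qed.

Lemma continuous_borel_measurable (f : 'rV[R]_d -> R) : continuous f ->
  measurable_fun setT (f : borel_space R d -> R).
Proof.
move=> cf; apply: (measurability _ (RGenOInfty.measurableE R)).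
move=> /= _ [_ [a ->]] <-; apply: measurableI => //.
apply: open_borel; move/continuousP : cf; apply.
by rewrite set_itvE; exact: open_gt.
Qed.

End Enorm.

(** * Countable conditions, inverses and complex-valued functions *)

Section MeasurablePrelim.
Context {dd : measure_display} {T : measurableType dd} {R : realType}.

Lemma measurable_forall_nat (P : nat -> T -> Prop) :
  (forall n, measurable [set y | P n y]) -> measurable [set y | forall n, P n y].
Proof.
move=> mP; rewrite (_ : mkset _ = \bigcap_n [set y | P n y]).
  exact: bigcapT_measurable.
by apply/seteqP; split=> [y yP n _|y yP n]; [exact: yP|exact: (yP n)].
Qed.

Lemma measurable_forall_count (I : countType) (P : I -> T -> Prop) :
  (forall i, measurable [set y | P i y]) -> measurable [set y | forall i, P i y].
Proof.
move=> mP; pose Q n y := if choice.unpickle n is Some i then P i y else True.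
rewrite (_ : mkset _ = [set y | forall n, Q n y]).
  apply: measurable_forall_nat => n; rewrite /Q.
  case: choice.unpickle => [i|]; first exact: mP.
  by rewrite (_ : mkset _ = setT)//; apply/seteqP; split.
apply/seteqP; split=> [y yP n|y yQ i]; first by rewrite /Q; case: choice.unpickle.
by have := yQ (choice.pickle i); rewrite /Q choice.pickleK.
Qed.

Lemma measurable_imply (Q : Prop) (P : T -> Prop) :
  (Q -> measurable [set y | P y]) -> measurable [set y | Q -> P y].
Proof.
move=> mP; have [q|nq] := pselect Q.
  rewrite (_ : mkset _ = [set y | P y]); first exact: mP.
  by apply/seteqP; split=> [y /(_ q)|y Py _].
rewrite (_ : mkset _ = setT) //.
by apply/seteqP; split=> // y _ /nq.
Qed.

Lemma measurable_le_cst (f : T -> R) (c : R) :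
  measurable_fun setT f -> measurable [set y | f y <= c].
Proof.
move=> mf; have := mf measurableT _ (measurable_itv `]-oo, c]).
by rewrite setTI preimage_itvNyc.
Qed.

Lemma measurable_lee_cst (f : T -> \bar R) (c : \bar R) :
  measurable_fun setT f -> measurable [set y | (f y <= c)%E].
Proof.
by move=> mf; have := emeasurable_fun_infty_c measurableT mf c; rewrite setTI.
Qed.

(** For a nonnegative f the inverse is the real power with exponent -1, also at 0, where both have
    the value 0. *)
Lemma measurable_funV (D : set T) (f : T -> R) : measurable D ->
  (forall x, D x -> 0 <= f x) ->
  measurable_fun D f -> measurable_fun D (fun x => (f x)^-1).
Proof.
move=> mD f0 mf.
apply: (@eq_measurable_fun _ _ _ _ _ (fun x => f x `^ (-1))).
  by move=> x /set_mem Dx; rewrite powR_inv1// f0.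
exact: (measurableT_comp (@measurable_powR R (-1))).
Qed.

Definition cmeasurable (D : set T) (f : T -> R[i]) :=
  measurable_fun D (fun x => complex.Re (f x)) /\
  measurable_fun D (fun x => complex.Im (f x)).

Lemma cmeasurableM D (f g : T -> R[i]) :
  cmeasurable D f -> cmeasurable D g -> cmeasurable D (fun x => f x * g x).
Proof.
move=> [fr fi] [gr gi]; split.
  rewrite (_ : (fun x => _) = (fun x => complex.Re (f x)) \* (fun x => complex.Re (g x))
     \- (fun x => complex.Im (f x)) \* (fun x => complex.Im (g x))).
    by apply: measurable_funB; apply: measurable_funM.
  by apply/funext => x /=; case: (f x); case: (g x).
rewrite (_ : (fun x => _) = (fun x => complex.Re (f x)) \* (fun x => complex.Im (g x))
   \+ (fun x => complex.Im (f x)) \* (fun x => complex.Re (g x))).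
  by apply: measurable_funD; apply: measurable_funM.
by apply/funext => x /=; case: (f x); case: (g x).
Qed.

Lemma cmeasurableX D (f : T -> R[i]) n :
  cmeasurable D f -> cmeasurable D (fun x => f x ^+ n).
Proof.
move=> mf; elim: n => [|n ih].
  by split; under eq_fun do rewrite expr0; exact: measurable_cst.
rewrite (_ : (fun x => _) = (fun x => f x * f x ^+ n)).
  exact: cmeasurableM.
by apply/funext => x; rewrite exprS.
Qed.

Lemma cmeasurableJ D (f : T -> R[i]) :
  cmeasurable D f -> cmeasurable D (fun x => (f x)^*%C).
Proof.
move=> [fr fi]; split.
  rewrite (_ : (fun x => _) = (fun x => complex.Re (f x)))//.
  by apply/funext => x; case: (f x).
rewrite (_ : (fun x => _) = \- (fun x => complex.Im (f x))).
  exact: measurable_funN.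
by apply/funext => x /=; case: (f x).
Qed.

Lemma cmeasurableV D (f : T -> R[i]) : measurable D ->
  cmeasurable D f -> cmeasurable D (fun x => (f x)^-1).
Proof.
move=> mD [fr fi].
have mn : measurable_fun D (fun x => (complex.Re (f x) ^+ 2 + complex.Im (f x) ^+ 2)^-1).
  apply: measurable_funV => //; first by move=> x _; rewrite addr_ge0 ?sqr_ge0.
  by apply: measurable_funD; exact: measurable_funX.
split.
  rewrite (_ : (fun x => _) = (fun x => complex.Re (f x)) \*
     (fun x => (complex.Re (f x) ^+ 2 + complex.Im (f x) ^+ 2)^-1)).
    exact: measurable_funM.
  by apply/funext => x /=; case: (f x).
rewrite (_ : (fun x => _) = \- ((fun x => complex.Im (f x)) \*
   (fun x => (complex.Re (f x) ^+ 2 + complex.Im (f x) ^+ 2)^-1))).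
  by apply: measurable_funN; exact: measurable_funM.
by apply/funext => x /=; case: (f x).
Qed.

End MeasurablePrelim.

(** * Measurability of the events *)

Section EventsMeasurable.
Context {R : realType} {d : nat} (S : set 'rV[R]_d) (b : nat -> nat).
Hypothesis S_closed : closed S.
Context (varpi : nat -> 'rV[R]_d -> R[i]).
Hypothesis varpi_lip : forall N, (0 < N)%N -> exists C, forall x w,
  cabs (varpi N x - varpi N w) <= C * enorm (x - w).
Hypothesis varpi_mono : forall N, (0 < N)%N -> forall x w,
  (cabs (varpi N x) < cabs (varpi N w)) = (enorm x < enorm w).

Lemma open_S_ball r : open [set x : 'rV[R]_d | enorm x < (b r)%:R].
Proof.
have /continuousP h := @continuous_enorm R d.
exact: (h _ (@open_lt R (b r)%:R)).
Qed.

Lemma measurable_S : measurable (S : set (borel_space R d)).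
Proof.
rewrite -[S]setCK; apply: (@measurableC _ (borel_space R d) (~` S)).
by apply: open_borel; exact: closed_openC.
Qed.

Lemma measurable_S_ r : measurable (S_ S b r : set (borel_space R d)).
Proof.
apply: (@measurableI _ (borel_space R d) S [set x | enorm x < (b r)%:R]).
  exact: measurable_S.
by apply: open_borel; exact: open_S_ball.
Qed.

Lemma measurable_S_shell r s : measurable (S_shell S b r s : set (borel_space R d)).
Proof. by apply: (@measurableD _ (borel_space R d)); exact: measurable_S_. Qed.

Lemma measurable_S_out r : measurable (S_out S b r : set (borel_space R d)).
Proof.
apply: (@measurableD _ (borel_space R d)); last exact: measurable_S_.
exact: measurable_S.
Qed.

Lemma S_shell_bounded r s x : S_shell S b r s x -> `|x| <= (b s)%:R.
Proof.
by move=> [[_ xs] _]; apply: le_trans (mx_norm_le_enorm x) (ltW xs).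
Qed.

Lemma finite_labels_shell (y : config S) r s : finite_set (labels_in y (S_shell S b r s)).
Proof. exact: (finite_labels_bounded y (@S_shell_bounded r s)). Qed.

Lemma cmeasurable_varpi N (D : set (borel_space R d)) : (0 < N)%N -> measurable D ->
  cmeasurable D (varpi N : borel_space R d -> R[i]).
Proof.
move=> /varpi_lip[C hC] mD.
have ReB (z w : R[i]) : complex.Re (z - w) = complex.Re z - complex.Re w by rewrite ReD ReN.
have ImB (z w : R[i]) : complex.Im (z - w) = complex.Im z - complex.Im w by case: z; case: w.
split; apply: (@measurable_funS _ _ (borel_space R d) R setT) => //;
  apply: continuous_borel_measurable; apply: (@enorm_lipschitz_continuous _ _ _ C) => x w.
- by rewrite -ReB; exact: le_trans (normRe_le_cabs _) (hC x w).
- by rewrite -ImB; exact: le_trans (normIm_le_cabs _) (hC x w).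
Qed.

Lemma continuous_cabs_varpi N (c : R[i]) : (0 < N)%N ->
  continuous (fun x => cabs (varpi N x - c)).
Proof.
move=> /varpi_lip[C hC]; apply: (@enorm_lipschitz_continuous _ _ _ C) => x w.
have tri (z1 z2 : R[i]) : cabs z1 - cabs z2 <= cabs (z1 - z2) by exact: le_cabsB.
apply: le_trans (hC x w).
have E : varpi N x - varpi N w = (varpi N x - c) - (varpi N w - c).
  by rewrite opprB addrA subrK.
by rewrite ler_norml lerNl opprB E tri andbT (cabs_distC (varpi N x - c)) tri.
Qed.

Lemma measurable_U r l k : measurable (U_ (S := S) b varpi r l k).
Proof.
(* Squaring turns the modulus into a polynomial in two real sums over points, each measurable by
   [measurable_psum]. *)
rewrite (_ : U_ _ _ _ _ _ = [set y : config_space S | forall N : nat, forall s : nat,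
    (0 < N)%N /\ (r < s)%N ->
    complex.Re (psum (y : config S) (S_shell S b r s) (fun x => 1 / (varpi N x)^*%C ^+ l)) ^+ 2 +
    complex.Im (psum (y : config S) (S_shell S b r s) (fun x => 1 / (varpi N x)^*%C ^+ l)) ^+ 2
    <= k%:R ^+ 2]); last first.
  apply/seteqP; split=> y /=.
    move=> /ereal_supP h N s [N0 rs].
    have /h : [set (cabs (psum (y : config S) (S_shell S b r s)
                    (fun x => 1 / ((varpi N x)^* )%C ^+ l)))%:E
      | N in [set N | (0 < N)%N] & s in [set s | (r < s)%N]] 
       (cabs (psum (y : config S) (S_shell S b r s)
                    (fun x => 1 / ((varpi N x)^* )%C ^+ l)))%:E.
      by exists N => //; exists s.
    by rewrite lee_fin -sqr_cabs => hh; rewrite lerXn2r ?nnegrE ?cabs_ge0.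
  move=> h; apply/ereal_supP => _ [N N0 [s rs <-]].
  have := h N s (conj N0 rs); rewrite -sqr_cabs lee_fin.
  by rewrite ler_pXn2r ?nnegrE ?cabs_ge0.
apply: measurable_forall_nat => N; apply: measurable_forall_nat => s.
apply: measurable_imply => -[N0 rs].
have [mRe mIm] : cmeasurable (S_shell S b r s : set (borel_space R d))
    (fun x : borel_space R d => 1 / (varpi N x)^*%C ^+ l).
  under eq_fun do rewrite div1r.
  have mA := measurable_S_shell r s.
  by apply: cmeasurableV => //; apply: cmeasurableX; apply: cmeasurableJ; exact: cmeasurable_varpi.
apply: measurable_le_cst; apply: measurable_funD; apply: measurable_funX.
  apply: eq_measurable_fun (measurable_psum (measurable_S_shell r s) (@S_shell_bounded r s) mRe).
  by move=> y _; rewrite !psumE ?Re_sum//; exact: finite_labels_shell.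
apply: eq_measurable_fun (measurable_psum (measurable_S_shell r s) (@S_shell_bounded r s) mIm).
by move=> y _; rewrite !psumE ?Im_sum//; exact: finite_labels_shell.
Qed.

Lemma enorm_real_point (t : R) : (0 < d)%N -> enorm (real_point t : 'rV[R]_d) = `|t|.
Proof.
move=> d0; rewrite -sqrtr_sqr /enorm; congr Num.sqrt.
rewrite (bigD1 (Ordinal d0))//= mxE/= big1 ?addr0// => j j0.
rewrite mxE; case: eqP => [e|_]; last by rewrite expr0n.
by case/eqP: j0; apply/val_inj.
Qed.

Lemma varpi_le N x w : (0 < N)%N -> enorm x <= enorm w ->
  cabs (varpi N x) <= cabs (varpi N w).
Proof. by move=> N0; rewrite !leNgt varpi_mono. Qed.

Lemma varpi_out_ge N r x : (0 < d)%N -> (0 < N)%N -> S_out S b r x ->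
  cabs (varpi N (real_point (b r)%:R)) <= cabs (varpi N x).
Proof.
move=> d0 N0 [Sx nx]; apply: varpi_le => //.
rewrite enorm_real_point// normr_nat leNgt; apply/negP => h.
exact: nx.
Qed.

Lemma measurable_Ubar r l k : (0 < d)%N -> measurable (Ubar_ (S := S) b varpi r l k).
Proof.
move=> d0.
pose rho N := cabs (varpi N (real_point (b r)%:R)) ^+ l.
rewrite (_ : Ubar_ _ _ _ _ _ = [set y : config_space S | forall N : nat, (0 < N)%N ->
    (pesum (y : config S) (S_out S b r)
       (fun x => ((cabs (varpi N x) ^+ l - rho N)%:E)^-1) <= k%:R%:E)%E]); last first.
  apply/seteqP; split=> y /=.
    by move=> /ereal_supP h N N0; apply: h; exists N.
  by move=> h; apply/ereal_supP => _ [N N0 <-]; exact: h.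
apply: measurable_forall_nat => N; apply: measurable_imply => N0.
have mO := measurable_S_out r.
have t0 x : S_out S b r x -> 0 <= cabs (varpi N x) ^+ l - rho N.
  by move=> Sx; rewrite subr_ge0 lerXn2r ?nnegrE ?cabs_ge0// varpi_out_ge.
have mt : measurable_fun (S_out S b r : set (borel_space R d))
    (fun x : borel_space R d => cabs (varpi N x) ^+ l - rho N).
  apply: (@measurable_funS _ _ (borel_space R d) R setT) => //.
  apply: measurable_funB => //; apply: measurable_funX.
  apply: continuous_borel_measurable.
  have := @continuous_cabs_varpi N 0 N0; rewrite (_ : (fun x => _) = fun x => cabs (varpi N x))//.
  by apply/funext => x; rewrite subr0.
apply: measurable_lee_cst; apply: measurable_pesum => //.
  by move=> x /t0 tx; rewrite inve_ge0 lee_fin.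
(* The extended inverse is +oo at 0 and the real inverse elsewhere, so measurability is proved by
   cases on the vanishing of the denominator. *)
under eq_fun do rewrite inver.
have m0 : measurable_fun (S_out S b r : set (borel_space R d))
    (fun x : borel_space R d => cabs (varpi N x) ^+ l - rho N == 0).
  exact: measurable_fun_eqr.
apply: measurable_fun_if => //.
apply: (measurableT_comp (@EFin_measurable R setT)).
apply: measurable_funV.
- exact: m0.
- by move=> x [/t0].
- by apply: measurable_funS mt => // x [].
Qed.

Hypothesis S_regular : closure (interior S) = S.

(** A closed set may well avoid all rational points; S cannot, being the closure of its interior:
    close to x there is an interior point of S, and a whole ball of S around that point. *)
Lemma rat_dense_S_ r x (V : set 'rV[R]_d) : S_ S b r x -> nbhs x V ->
  exists q : 'rV[rat]_d, S_ S b r (map_mx ratr q) /\ V (map_mx ratr q).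
Proof.
move=> [Sx xr] Vx.
have cx : closure (interior S) x by rewrite S_regular.
have nx : nbhs x (V° `&` [set x | enorm x < (b r)%:R]).
  apply: filterI; first exact: nbhs_interior.
  by apply: open_nbhs_nbhs; split=> //; exact: open_S_ball.
have [z [Sz [Vz zr]]] := cx _ nx.
have : nbhs z ((interior S `&` V°) `&` [set x | enorm x < (b r)%:R]).
  apply: open_nbhs_nbhs; split; last by [].
  by apply: openI; [apply: openI; exact: open_interior|exact: open_S_ball].
move=> /nbhs_ballP[e /= e0 he].
have /choice[f hf] : forall j, exists q : rat, ratr q \in `]z 0 j - e, z 0 j + e[.
  by move=> j; apply: rat_in_itvoo; lra.
exists (\row_j f j).
have /he [[/interior_subset Sq /interior_subset Vq] rq] : ball z e (map_mx ratr (\row_j f j)).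
  split=> // i j; rewrite !mxE (ord1 i) /ball/= ltr_distlC.
  by have := hf j; rewrite in_itv.
by split=> //; split.
Qed.

Lemma dense_le0 r (h : 'rV[R]_d -> R) x : S_ S b r x -> {for x, continuous h} ->
  (forall q : 'rV[rat]_d, S_ S b r (map_mx ratr q) -> h (map_mx ratr q) <= 0) ->
  h x <= 0.
Proof.
move=> Sx ch hq; rewrite leNgt; apply/negP => hx.
have Vx : nbhs x (h @^-1` [set t | 0 < t]).
  by apply: ch; apply: open_nbhs_nbhs; split=> //; exact: open_gt.
have [q [Sq /= hq0]] := rat_dense_S_ Sx Vx.
by move: hq0; rewrite ltNge hq.
Qed.

Context (beta : R).

(** The only danger is the singularity of the logarithm. The points summed lie outside S_r, so by
    [varpi_mono] their images have a strictly larger modulus than that of x. *)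
Lemma continuous_PsiN_shell N r s (y : config S) x : (0 < N)%N ->
  S_ S b r x -> {for x, continuous (fun x => PsiN_shell b varpi beta N r s x y)}.
Proof.
move=> N0 [Sx xr].
have fs := finite_labels_shell y r s.
(* Membership becomes a side condition of the sum, so that each summand comes with the fact that its
   point is in the shell. *)
rewrite (_ : (fun _ => _) = fun x => \sum_(i <- fset_set (labels_in y (S_shell S b r s))
    | i \in fset_set (labels_in y (S_shell S b r s)))
    PsiN varpi beta N x ((labels y).2 i)); last first.
  by apply/funext => w; rewrite /PsiN_shell psumE// big_seq.
apply: (@cvg_big R _ +%R 0); [by move=> z; exact: add_continuous|exact: (nbhs_filter x)|].
move=> i; rewrite in_fset_set// => /set_mem[_ [Si nSi]].
apply: (@continuousM R 'rV[R]_d (cst (- beta)) (fun x => ln (cabs (varpi N x - varpi N ((labels y).2 i))))).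
  exact: cst_continuous.
apply: (@continuous_comp 'rV[R]_d R R (fun x => cabs (varpi N x - varpi N ((labels y).2 i))) (@ln R)).
  exact: continuous_cabs_varpi.
apply: continuous_ln; rewrite cabs_distC; apply: lt_le_trans (le_cabsB _ _).
rewrite subr_gt0 varpi_mono//; apply: lt_le_trans xr _.
by rewrite leNgt; apply/negP => h; apply: nSi; split=> //; case: Si.
Qed.

Lemma measurable_PsiN_shell N r s x : (0 < N)%N ->
  measurable_fun setT (fun y : config_space S => PsiN_shell b varpi beta N r s x (y : config S) : R).
Proof.
move=> N0; apply: (measurable_psum (measurable_S_shell r s) (@S_shell_bounded r s)).
apply: (@measurable_funS _ _ (borel_space R d) R setT) => //.
apply: measurable_funM => //; apply: (measurableT_comp (@measurable_ln R)).
apply: continuous_borel_measurable.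
have := @continuous_cabs_varpi N (varpi N x) N0.
by rewrite (_ : (fun _ => _) = fun w => cabs (varpi N x - varpi N w))//; apply/funext => w; rewrite cabs_distC.
Qed.

(** Without the quotient, the condition also makes sense for x = w and is continuous in x and w, as
    the passage to rational points requires. *)
Lemma H_lipschitz r k (y : config S) : H_ b varpi beta r k y <->
  forall N s, (0 < N)%N /\ (r < s)%N -> forall x w, S_ S b r x -> S_ S b r w ->
    `|PsiN_shell b varpi beta N r s x y - PsiN_shell b varpi beta N r s w y|
    <= k%:R * enorm (x - w).
Proof.
split=> [/ereal_supP h N s [N0 rs] x w Sx Sw|h].
  have [->|xw] := eqVneq x w; first by rewrite !subrr normr0 enorm0 mulr0.
  have e0 : 0 < enorm (x - w) by rewrite lt_neqAle enorm_ge0 eq_sym enorm_eq0 subr_eq0 xw.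
  rewrite -ler_pdivrMr// -lee_fin; apply: le_trans (h _ _); last by exists N => //; exists s.
  by apply: ereal_sup_ubound; exists (x, w) => //; split=> //; exact/eqP.
apply/ereal_supP => _ [N N0 [s rs <-]]; apply/ereal_supP => _ [[x w] /= [Sx Sw xw] <-].
have e0 : 0 < enorm (x - w).
  by rewrite lt_neqAle enorm_ge0 eq_sym enorm_eq0 subr_eq0; apply/andP; split=> //; exact/eqP.
by rewrite lee_fin ler_pdivrMr//; exact: h.
Qed.

Lemma measurable_H r k : measurable (H_ (S := S) b varpi beta r k).
Proof.
pose P N s x w (y : config S) :=
  `|PsiN_shell b varpi beta N r s x y - PsiN_shell b varpi beta N r s w y|
    - k%:R * enorm (x - w).
rewrite (_ : H_ _ _ _ _ _ = [set y : config_space S | forall N s : nat,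
    (0 < N)%N /\ (r < s)%N -> forall p q : 'rV[rat]_d,
    S_ S b r (map_mx ratr p) -> S_ S b r (map_mx ratr q) ->
    P N s (map_mx ratr p) (map_mx ratr q) (y : config S) <= 0]); last first.
  apply/seteqP; split=> y /=.
    move=> /H_lipschitz h N s Ns p q Sp Sq; rewrite subr_le0.
    exact: h.
  move=> h; apply/H_lipschitz => N s Ns x w Sx Sw; rewrite -subr_le0.
  have cP z w' : S_ S b r z -> {for z, continuous (fun x => P N s x w' y)}.
    move=> Sz; apply: (@continuousB R R 'rV[R]_d).
      apply: (@continuous_comp 'rV[R]_d R R _ Num.norm); last exact: norm_continuous.
      apply: (@continuousB R R 'rV[R]_d); last exact: cst_continuous.
      by apply: continuous_PsiN_shell => //; case: Ns.
    apply: (@continuousM R 'rV[R]_d (cst k%:R)); first exact: cst_continuous.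
    exact: continuous_enormB.
  (* Density is applied to one variable at a time; by this symmetry, continuity in the first
     variable serves for both. *)
  have PC x' w' : P N s x' w' y = P N s w' x' y.
    by rewrite /P distrC -(enormN (x' - w')) opprB.
  apply: (dense_le0 Sx (cP _ _ Sx)) => q Sq; rewrite PC.
  apply: (dense_le0 Sw (cP _ _ Sw)) => p Sp.
  exact: h.
apply: measurable_forall_nat => N; apply: measurable_forall_nat => s.
apply: measurable_imply => -[N0 rs].
apply: measurable_forall_count => p; apply: measurable_forall_count => q.
apply: measurable_imply => Sp; apply: measurable_imply => Sq.
apply: measurable_le_cst; apply: measurable_funB => //.
apply: (measurableT_comp (@normr_measurable R setT)).
by apply: measurable_funB; exact: measurable_PsiN_shell.
Qed.

End EventsMeasurable.

(** * Limits of probabilities *)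

Section LimnEsup.
Context {R : realType}.
Implicit Types u : (\bar R)^nat.

Lemma limn_esup_lt_near u (c : \bar R) :
  (limn_esup u < c)%E -> \forall N \near \oo, (u N < c)%E.
Proof.
move=> /ereal_inf_lt[_ [A Aoo <-] hA].
apply: filterS Aoo => N AN; apply: le_lt_trans hA.
by apply: ereal_sup_ubound; exists N.
Qed.

Lemma limn_esup_le_near u (c : \bar R) :
  (\forall N \near \oo, (u N <= c)%E) -> (limn_esup u <= c)%E.
Proof.
move=> hu; apply: (@ge_ereal_inf _ _ _); exists (ereal_sup [set u x | x in [set N | (u N <= c)%E]]).
  by exists [set N | (u N <= c)%E].
by apply: ge_ereal_sup => _ [N uN <-].
Qed.

Lemma limn_esup_ge0 u : (forall N, (0 <= u N)%E) -> (0 <= limn_esup u)%E.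
Proof.
move=> u0; apply: le_ereal_inf_tmp => _ [A Aoo <-].
have [N AN] := filter_ex Aoo.
by apply: le_trans (u0 N) _; apply: ereal_sup_ubound; exists N.
Qed.

End LimnEsup.

Lemma near_forall_ltn (P : nat -> nat -> Prop) (n : nat) :
  (forall l, (l < n)%N -> \forall k \near \oo, P l k) ->
  \forall k \near \oo, forall l, (l < n)%N -> P l k.
Proof.
elim: n => [|n ih] h; first exact: nearW.
have h1 : \forall k \near \oo, forall l, (l < n)%N -> P l k.
  by apply: ih => l ln; apply: h; exact: ltnW.
have h2 := h n (ltnSn n).
apply: filterS2 h1 h2 => k h1 h2 l; rewrite ltnS leq_eqVlt => /predU1P[->//|].
exact: h1.
Qed.

Section ComplVanish.
Context {R : realType} {d : nat} {S : set 'rV[R]_d}.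
Context (mu : nat -> probability (config_space S) R).

(* Measurability is what makes [mu N] monotone: a MathComp-Analysis measure is
   unconstrained outside of the measurable sets. *)
Lemma compl_vanish_sub (n C : nat) (A : nat -> nat -> set (config_space S))
    (B : nat -> set (config_space S)) :
  (forall l k, (l < n)%N -> measurable (A l k)) -> (forall k, measurable (B k)) ->
  (forall j k, (j <= k)%N -> B j `<=` B k) ->
  (forall k y, (forall l, (l < n)%N -> A l k y) -> B (C * k)%N y) ->
  (forall l, (l < n)%N -> compl_vanish mu (A l)) -> compl_vanish mu B.
Proof.
move=> mA mB homoB AB vA.
apply: limn_esup_le_cvg; last first.
  by move=> k; apply: limn_esup_ge0 => N; exact: measure_ge0.
apply/lee_addgt0Pr => e e0; rewrite add0e.
(* The tolerance e is shared among n events; dividing by n + 1 instead of n also covers n = 0. *)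
have en0 : 0 < e / n.+1%:R by rewrite divr_gt0.
have [k hk] : exists k, forall l, (l < n)%N ->
    (limn_esup (fun N => mu N (~` A l k)) < (e / n.+1%:R)%:E)%E.
  apply: (@filter_ex _ \oo); apply: near_forall_ltn => l ln.
  apply: (vA l ln [set x | (x < (e / n.+1%:R)%:E)%E]).
  apply: open_nbhs_nbhs; split; first exact: open_ereal_lt_ereal.
  by rewrite /= lte_fin.
have hN : \forall N \near \oo, forall l, (l < n)%N ->
    (mu N (~` A l k) < (e / n.+1%:R)%:E)%E.
  by apply: near_forall_ltn => l /hk; exact: limn_esup_lt_near.
apply: limn_esup_le_near; exists (C * k)%N => // k' /= kk'.
apply: limn_esup_le_near; apply: filterS hN => N hN.
have sub : ~` B k' `<=` \big[setU/set0]_(l < n) ~` A l k.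
  move=> y nB; rewrite -(bigcup_mkord n (fun l => ~` A l k)).
  apply: contrapT => h; apply: nB; apply: (homoB _ _ kk'); apply: AB => l ln.
  by apply: contrapT => nA; apply: h; exists l.
have mAC l : (l < n)%N -> measurable (~` A l k) by move=> ln; apply: measurableC; exact: mA.
apply: (@le_trans _ _ (mu N (\big[setU/set0]_(l < n) ~` A l k))).
  apply: (@le_measure _ _ _ (mu N)) => //; rewrite inE; first exact: measurableC.
  by apply: bigsetU_measurable => l _; exact: mAC.
apply: le_trans (Boole_inequality _ mAC) _.
apply: (@le_trans _ _ (\sum_(l < n) (e / n.+1%:R)%:E)%E).
  by apply: lee_sum => l _; exact/ltW/hN.
rewrite sumEFin lee_fin sumr_const card_ord -[leLHS]mulr_natr -mulrA ler_piMr//; first exact: ltW.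
by rewrite ler_pdivrMl// mulr1 ler_nat.
Qed.

End ComplVanish.

(** * Reduction to properties of varpi *)

Section Reduction.
Context {R : realType} {d : nat} (S : set 'rV[R]_d) (b : nat -> nat).
Hypothesis d_gt0 : (0 < d)%N.
Hypothesis S_closed : closed S.
Hypothesis S_regular : closure (interior S) = S.
Context (varpi : nat -> 'rV[R]_d -> R[i]).
Hypothesis varpi0 : forall N, (0 < N)%N -> varpi N 0 = 0.
Hypothesis varpi_lip : forall N, (0 < N)%N -> exists C, forall x w,
  cabs (varpi N x - varpi N w) <= C * enorm (x - w).
Hypothesis varpi_lip_unif : forall B, exists C, forall N, (0 < N)%N ->
  forall x w, enorm x <= B -> enorm w <= B ->
  cabs (varpi N x - varpi N w) <= C * enorm (x - w).
Hypothesis varpi_mono : forall N, (0 < N)%N -> forall x w,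
  (cabs (varpi N x) < cabs (varpi N w)) = (enorm x < enorm w).
Context (beta : R).

Let Rho N r : R := cabs (varpi N (real_point (b r)%:R)).

(** In case of equality the point would add 0^-1 = +oo to a sum that is at most k. *)
Lemma Ubar_gt r l k N (y : config S) i : (0 < N)%N ->
  Ubar_ b varpi r l k y -> labels_in y (S_out S b r) i ->
  Rho N r < cabs (varpi N ((labels y).2 i)).
Proof.
move=> N0 yU yi; have Si := yi.2.
have hle : Rho N r <= cabs (varpi N ((labels y).2 i)).
  by apply: varpi_out_ge Si.
rewrite lt_neqAle hle andbT; apply/negP => /eqP e.
move/ereal_supP : yU.
set F := (fun x => _); move=> /(_ (pesum y (S_out S b r)
  (fun x => ((cabs (varpi N x) ^+ l - Rho N r ^+ l)%:E)^-1)%E)).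
move=> /(_ (ex_intro2 _ _ N N0 erefl)).
apply/negP; rewrite -ltNge; apply: (@lt_le_trans _ _ +oo%E); first exact: ltry.
apply: esum_ge; exists [set i].
  by split; [exact: finite_set1|move=> _ ->].
by rewrite fsbig_set1 -e subrr inve0.
Qed.

(** A finite part of the sum in [Ubar_]. By [Ubar_gt] and l > 0 each denominator is positive, so the
    extended inverses are real ones. *)
Lemma Ubar_sum_le r l k N s (y : config S) : (0 < N)%N ->
  (0 < l)%N -> Ubar_ b varpi r l k y ->
  \sum_(i <- fset_set (labels_in y (S_shell S b r s)))
    (cabs (varpi N ((labels y).2 i)) ^+ l - Rho N r ^+ l)^-1 <= k%:R.
Proof.
move=> N0 l0 yU; rewrite -lee_fin.
move/ereal_supP : (yU) => /(_ (pesum y (S_out S b r)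
  (fun x => ((cabs (varpi N x) ^+ l - Rho N r ^+ l)%:E)^-1)%E)).
move=> /(_ (ex_intro2 _ _ N N0 erefl)); apply: le_trans.
have fs := finite_labels_shell b y r s.
apply: esum_ge; exists (labels_in y (S_shell S b r s)).
  by split=> // i [Ii [[Si _] nSi]].
rewrite fsbig_finite//= -sumEFin big_seq [leRHS]big_seq.
apply: lee_sum => i; rewrite in_fset_set// => /set_mem[Ii [[Si _] nSi]].
rewrite inver ifF//; apply/negbTE.
rewrite subr_eq0 gt_eqF// ltrXn2r ?nnegrE ?cabs_ge0 -?lt0n//.
by apply: Ubar_gt yU _.
Qed.

Lemma H_of_Ubar_U r l0 : (0 < l0)%N -> exists C : nat, forall k (y : config_space S),
  Ubar_ b varpi r l0 k y -> (forall l, (1 <= l < l0)%N -> U_ b varpi r l k y) ->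
  H_ b varpi beta r (C * k) y.
Proof.
case: l0 => // m _.
have [L0 hL0] := varpi_lip_unif (b r)%:R.
pose L := Num.max L0 0.
have hL N x w : (0 < N)%N -> enorm x <= (b r)%:R -> enorm w <= (b r)%:R ->
    cabs (varpi N x - varpi N w) <= L * enorm (x - w).
  move=> N0 hx hw; apply: le_trans (hL0 N N0 x w hx hw) _.
  by rewrite ler_wpM2r ?enorm_ge0// le_max lexx.
have L_ge0 : 0 <= L by rewrite le_max lexx orbT.
(* Since varpi_N fixes 0, this bounds rho = |varpi_N(b_r)| for every N at once, which makes D
   independent of N. *)
pose rb := L * (b r)%:R.
have rb0 : 0 <= rb by rewrite mulr_ge0.
pose D := `|beta| * (L * (\sum_(j < m) rb ^+ j + m.+1%:R * rb ^+ m)).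
exists (Num.truncn D).+1 => k y yUbar yU.
apply/H_lipschitz => N s [N0 rs] x w [Sx xr] [Sw wr].
have fs := finite_labels_shell b (y : config S) r s.
have hrho : Rho N r <= rb.
  have := hL N (real_point (b r)%:R) 0 N0.
  rewrite varpi0// !subr0 enorm_real_point// enorm0 normr_nat lexx.
  by apply.
have lerho z : enorm z < (b r)%:R -> cabs (varpi N z) <= Rho N r.
  move=> zr; apply/varpi_le => //; rewrite enorm_real_point// normr_nat.
  exact: ltW.
have h := @sum_log_le R _ (fset_set (labels_in (y : config S) (S_shell S b r s)))
  (fun i => varpi N ((labels (y : config S)).2 i)) (varpi N x) (varpi N w)
  (Rho N r) k%:R m (lerho x xr) (lerho w wr).
rewrite /PsiN_shell !psumE// -sumrB.
under eq_bigr do rewrite /PsiN -mulrBr.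
rewrite -mulr_sumr normrM normrN.
apply: (@le_trans _ _ (`|beta| * (cabs (varpi N x - varpi N w) * k%:R *
   (\sum_(j < m) Rho N r ^+ j + m.+1%:R * Rho N r ^+ m)))).
  rewrite ler_wpM2l// h//.
  - move=> i; rewrite in_fset_set// => /set_mem[Ii [[Si _] nSi]].
    by apply: Ubar_gt yUbar _.
  - move=> j jm.
    have /ereal_supP := yU j.+1 jm; rewrite /= => hj.
    rewrite -lee_fin -(psumE (fun x => 1 / (varpi N x)^*%C ^+ j.+1))//.
    by apply: hj; exists N => //; exists s.
  - exact: Ubar_sum_le yUbar.
apply: (@le_trans _ _ (D * k%:R * enorm (x - w))).
  rewrite /D -!mulrA ler_wpM2l//.
  rewrite [leRHS](_ : _ = L * enorm (x - w) * (k%:R * (\sum_(j < m) rb ^+ j + m.+1%:R * rb ^+ m))); last by ring.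
  apply: ler_pM; rewrite ?cabs_ge0 ?mulr_ge0//.
  - by rewrite addr_ge0 ?sumr_ge0 ?mulr_ge0 ?exprn_ge0 ?cabs_ge0// => j _; rewrite exprn_ge0 ?cabs_ge0.
  - by apply: hL => //; exact: ltW.
  - rewrite ler_wpM2l// lerD//.
      by apply: ler_sum => j _; rewrite lerXn2r ?nnegrE ?cabs_ge0.
    by rewrite ler_wpM2l// lerXn2r ?nnegrE ?cabs_ge0.
rewrite ler_wpM2r ?enorm_ge0// natrM ler_wpM2r//.
exact/ltW/truncnS_gt.
Qed.

Lemma H_homo r j k : (j <= k)%N -> H_ (S := S) b varpi beta r j `<=` H_ b varpi beta r k.
Proof.
move=> jk y /H_lipschitz h; apply/H_lipschitz => N s Ns x w Sx Sw.
apply: le_trans (h N s Ns x w Sx Sw) _.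
by rewrite ler_wpM2r ?enorm_ge0// ler_nat.
Qed.

Lemma A5_of_A6 (mu : nat -> probability (config_space S) R) :
  (forall r, (0 < r)%N -> exists l0, [/\ (0 < l0)%N,
        compl_vanish mu (Ubar_ b varpi r l0) &
        forall l, (1 <= l < l0)%N -> compl_vanish mu (U_ b varpi r l)]) ->
  forall r, (0 < r)%N -> compl_vanish mu (H_ b varpi beta r).
Proof.
move=> A6 r /A6[l0 [l00 vUbar vU]].
have [C hC] := H_of_Ubar_U r l00.
(* The conclusion needs exactly l0 events: [Ubar_] and the [U_] with 1 <= l < l0. The free index 0
   is given to [Ubar_]. *)
pose A l := if l is 0%N then Ubar_ (S := S) b varpi r l0 else U_ b varpi r l.
apply: (@compl_vanish_sub R d S mu l0 C A).
- move=> [|l] k ln; first exact: measurable_Ubar.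
  exact: measurable_U.
- by move=> k; exact: measurable_H.
- by move=> j k jk; exact: H_homo.
- move=> k y hA; apply: hC; first exact: (hA 0%N).
  by move=> [|l] // ll0; exact: (hA l.+1).
- by move=> [|l] ll0 //; exact: vU.
Qed.

End Reduction.

(** * The circle map *)

Section Trig.
Context {R : realType}.
Implicit Types x t s : R.

Lemma sin_le_id x : 0 <= x -> sin x <= x.
Proof.
rewrite le_eqVlt => /predU1P[<-|x0]; first by rewrite sin0.
have [c _] := MVT x0 (fun c _ => is_derive_sin c)
  (derivable_within_continuous (fun c _ => @derivable_sin R c)).
by rewrite sin0 !subr0 => ->; rewrite ler_piMl ?cos_le1// ltW.
Qed.

Lemma norm_sin_le x : `|sin x| <= `|x|.
Proof.
wlog x0 : x / 0 <= x.
  move=> H; have [|/ltW xle0] := leP 0 x; first exact: H.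
  by have := H (- x); rewrite sinN !normrN oppr_ge0; apply.
have [x1|x1] := leP x 1; last first.
  rewrite (ger0_norm x0); apply: le_trans (ltW x1); rewrite ler_norml.
  by rewrite sin_le1 sin_geN1.
have sx : 0 <= sin x.
  by apply: sin_ge0_pi; rewrite x0/= (le_trans x1)// (le_trans _ (@pi_ge2 R))// ler1n.
by rewrite !ger0_norm// sin_le_id.
Qed.

Lemma one_sub_cos x : 1 - cos x = 2 * sin (x / 2) ^+ 2.
Proof.
have {1}-> : x = (x / 2) *+ 2 by rewrite -mulr_natr divfK.
by rewrite cos_mulr2n cos2sin2; ring.
Qed.

Lemma one_sub_cos_le x : 1 - cos x <= x ^+ 2 / 2.
Proof.
rewrite one_sub_cos; have := norm_sin_le (x / 2).
rewrite -ler_sqr ?nnegrE// !real_normK ?num_real// => h.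
have -> : x ^+ 2 / 2 = 2 * (x / 2) ^+ 2 by field.
by rewrite ler_wpM2l.
Qed.

End Trig.

(** * Lipschitz bounds and monotone modulus of the circle map *)

Section CircleMapFacts.
Context {R : realType} (N : nat).
Hypothesis N_gt0 : (0 < N)%N.
Implicit Types x w a : R.

Let n : R := circle_length N.
(** The scale for all size comparisons: N + 1 <= X and n = X^4, so that N / n is at most X^-3. *)
Let X : R := (2 ^ N)%:R.

Let X_ge2 : 2 <= X.
Proof. by rewrite ler_nat -{1}(expn1 2) leq_exp2l. Qed.

Let N_leX : N.+1%:R <= X.
Proof. by rewrite ler_nat ltn_expl. Qed.

Let nE : n = X ^+ 4.
Proof. by rewrite /n /circle_length mulnC expnM natrX. Qed.

Let n_gt0 : 0 < n.
Proof. by rewrite nE exprn_gt0// (lt_le_trans _ X_ge2). Qed.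

Let N_ge0 : 0 <= N%:R :> R.
Proof. exact: ler0n. Qed.

(** The radius of the circle of circumference n. The inner map is the arc length parametrization of
    this circle, placed through 0 with centre i kappa. *)
Let kappa : R := n / (2 * pi).

Let kappa_gt0 : 0 < kappa.
Proof. by rewrite divr_gt0// mulr_gt0// pi_gt0. Qed.

Let angle x : 2 * pi * x / n = x / kappa.
Proof. by rewrite /kappa invf_div [RHS]mulrA (mulrC x). Qed.

Lemma circle_innerE x : circle_inner N x =
  (kappa * sin (x / kappa) +i* (kappa * (1 - cos (x / kappa))))%C.
Proof.
rewrite /circle_inner -/n -/kappa angle.
by apply/eqP; rewrite eq_complex /=; apply/andP; split; apply/eqP; ring.
Qed.

Lemma sqr_cabs_circle_inner x :
  cabs (circle_inner N x) ^+ 2 = kappa ^+ 2 * (2 * (1 - cos (x / kappa))).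
Proof.
rewrite circle_innerE sqr_cabs /= !exprMn sin2cos2; ring.
Qed.

Lemma circle_inner0 : circle_inner N 0 = 0 :> R[i].
Proof. by rewrite circle_innerE mul0r sin0 cos0 subrr !mulr0. Qed.

(** A chord is no longer than its arc: its squared length is 2 kappa^2 (1 - cos((x - w) /
    kappa)). *)
Lemma circle_inner_lip x w :
  cabs (circle_inner N x - circle_inner N w) <= `|x - w|.
Proof.
rewrite -ler_sqr ?nnegrE ?cabs_ge0// real_normK ?num_real//.
rewrite !circle_innerE sqr_cabs /=.
set s := x / kappa; set t := w / kappa.
have -> : (kappa * sin s - kappa * sin t) ^+ 2 +
  (kappa * (1 - cos s) - kappa * (1 - cos t)) ^+ 2 = kappa ^+ 2 * (2 * (1 - cos (s - t))).
  rewrite cosB.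
  have -> : (kappa * sin s - kappa * sin t) ^+ 2 +
    (kappa * (1 - cos s) - kappa * (1 - cos t)) ^+ 2 = kappa ^+ 2 *
    ((cos s ^+ 2 + sin s ^+ 2) + (cos t ^+ 2 + sin t ^+ 2)
       - 2 * (cos s * cos t + sin s * sin t)) by ring.
  by rewrite !cos2Dsin2; ring.
have -> : (x - w) ^+ 2 = kappa ^+ 2 * (2 * ((s - t) ^+ 2 / 2)).
  by rewrite /s /t; field; rewrite gt_eqF.
by rewrite !ler_wpM2l ?sqr_ge0// one_sub_cos_le.
Qed.

Lemma cabs_circle_inner_le x : cabs (circle_inner N x) <= `|x|.
Proof. by have := circle_inner_lip x 0; rewrite circle_inner0 !subr0. Qed.

(** The reflection in the imaginary axis. It makes the modulus even, so monotonicity need only be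
    proved for x >= 0. *)
Lemma circle_mapN x : circle_map N (- x) = - (circle_map N x)^*%C.
Proof.
have innerN a : circle_inner N (- a) = - (circle_inner N a)^*%C.
  rewrite !circle_innerE mulNr sinN cosN.
  by apply/eqP; rewrite eq_complex /= mulrN opprK !eqxx.
rewrite /circle_map normrN; case: ifP => _; first exact: innerN.
case: ifP => _.
  by apply/eqP; rewrite eq_complex /= !oppr0 !eqxx.
rewrite sgrN !mulNr innerN; case: (circle_inner N (Num.sg x * N%:R)) => p q.
by apply/eqP; rewrite eq_complex /=; apply/andP; split; apply/eqP; ring.
Qed.

Lemma cabs_circle_map_norm x : cabs (circle_map N x) = cabs (circle_map N `|x|).
Proof.
have [x0|x0] := leP 0 x; first by rewrite ger0_norm.
by rewrite ltr0_norm// circle_mapN cabsN cabsJ.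
Qed.

Let clamp (c x : R) := Num.max (- c) (Num.min c x).
Let ramp (x : R) := Num.max 0 (Num.min 1 x).

Let clamp_mid c x : `|x| <= c -> clamp c x = x.
Proof. by rewrite ler_norml => /andP[h1 h2]; rewrite /clamp min_r// max_r. Qed.

Let clamp_hi c x : 0 <= c -> c <= x -> clamp c x = c.
Proof. by move=> c0 cx; rewrite /clamp min_l// max_r//; lra. Qed.

Let clamp_lo c x : 0 <= c -> x <= - c -> clamp c x = - c.
Proof. by move=> c0 cx; rewrite /clamp min_r ?max_l//; lra. Qed.

Let ramp_lo x : x <= 0 -> ramp x = 0.
Proof. by move=> x0; rewrite /ramp min_r ?max_l//; lra. Qed.

Let ramp_mid x : 0 <= x <= 1 -> ramp x = x.
Proof. by case/andP=> x0 x1; rewrite /ramp min_r ?max_r. Qed.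

Let ramp_hi x : 1 <= x -> ramp x = 1.
Proof. by move=> x1; rewrite /ramp min_l// max_r. Qed.

Let N1 : N.+1%:R = N%:R + 1 :> R.
Proof. by rewrite -natr1. Qed.

(** A single formula on the whole line, built from 1-Lipschitz real functions. It spares the
    Lipschitz bound a discussion of pairs x, w lying in different pieces. *)
Let circle_map_clamp x : circle_map N x = circle_inner N (clamp N%:R x)
  + (ramp (x - N%:R))%:C%C * (N.+1%:R%:C%C - circle_inner N N%:R)
  + (ramp (- x - N%:R))%:C%C * (- N.+1%:R%:C%C - circle_inner N (- N%:R))
  + (x - clamp N.+1%:R x)%:C%C.
Proof.
have N0 := N_ge0; rewrite /circle_map.
have [xN|Nx] := ltP `|x| N%:R.
  have := ltW xN; rewrite ler_norml => /andP[h1 h2].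
  have -> : clamp N.+1%:R x = x by rewrite clamp_mid// N1; lra.
  have -> : ramp (x - N%:R) = 0 by rewrite ramp_lo//; lra.
  have -> : ramp (- x - N%:R) = 0 by rewrite ramp_lo//; lra.
  by rewrite clamp_mid ?ltW// !mul0r subrr !addr0.
have [Nx1|xN1] := leP N.+1%:R `|x|.
  have [x0|x0] := leP 0 x.
    rewrite ger0_norm// N1 in Nx1.
    have -> : clamp N.+1%:R x = N.+1%:R by rewrite N1 clamp_hi//; lra.
    have -> : clamp N%:R x = N%:R by rewrite clamp_hi//; lra.
    have -> : ramp (x - N%:R) = 1 by rewrite ramp_hi//; lra.
    have -> : ramp (- x - N%:R) = 0 by rewrite ramp_lo//; lra.
    by rewrite rmorphB rmorph1 rmorph0; ring.
  rewrite ltr0_norm// N1 in Nx1.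
  have -> : clamp N.+1%:R x = - N.+1%:R by rewrite N1 clamp_lo//; lra.
  have -> : clamp N%:R x = - N%:R by rewrite clamp_lo//; lra.
  have -> : ramp (x - N%:R) = 0 by rewrite ramp_lo//; lra.
  have -> : ramp (- x - N%:R) = 1 by rewrite ramp_hi//; lra.
  by rewrite rmorphB rmorphN rmorph1 rmorph0; ring.
rewrite (clamp_mid (ltW xN1)) subrr rmorph0 addr0.
have Np : 0 < N%:R :> R by rewrite ltr0n.
have [x0|x0] := leP 0 x.
  rewrite ger0_norm// in Nx xN1 *.
  have xp : 0 < x by lra.
  rewrite N1 in xN1.
  have -> : clamp N%:R x = N%:R by rewrite clamp_hi.
  have -> : ramp (x - N%:R) = x - N%:R by rewrite ramp_mid//; lra.
  have -> : ramp (- x - N%:R) = 0 by rewrite ramp_lo//; lra.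
  rewrite gtr0_sg// !mul1r rmorph0 mul0r addr0.
  have -> : (N.+1%:R - x)%:C%C = 1 - (x - N%:R)%:C%C :> R[i].
    by rewrite N1 !rmorphB rmorphD rmorph1; ring.
  by ring.
rewrite ltr0_norm// in Nx xN1 *.
rewrite N1 in xN1.
have -> : clamp N%:R x = - N%:R by rewrite clamp_lo//; lra.
have -> : ramp (x - N%:R) = 0 by rewrite ramp_lo//; lra.
have -> : ramp (- x - N%:R) = - x - N%:R by rewrite ramp_mid//; lra.
rewrite ltr0_sg// !mulN1r rmorph0 mul0r addr0 rmorphN.
have -> : (N.+1%:R - - x)%:C%C = 1 - (- x - N%:R)%:C%C :> R[i].
  by rewrite N1 !(rmorphB, rmorphD, rmorphN, rmorph1); ring.
by ring.
Qed.

Let max_lip (c x w : R) : `|Num.max c x - Num.max c w| <= `|x - w|.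
Proof.
rewrite /Num.max; case: ltP => h1; case: ltP => h2; rewrite ?subrr ?normr0//;
  rewrite ler_norml; have := ler_norm (x - w); have := ler_norm (w - x);
  rewrite (distrC w x) => h3 h4; apply/andP; split; lra.
Qed.

Let min_lip (c x w : R) : `|Num.min c x - Num.min c w| <= `|x - w|.
Proof.
rewrite /Num.min; case: ltP => h1; case: ltP => h2; rewrite ?subrr ?normr0//;
  rewrite ler_norml; have := ler_norm (x - w); have := ler_norm (w - x);
  rewrite (distrC w x) => h3 h4; apply/andP; split; lra.
Qed.

Let clamp_lip c x w : `|clamp c x - clamp c w| <= `|x - w|.
Proof. exact: le_trans (max_lip _ _ _) (min_lip _ _ _). Qed.

Let ramp_lip x w : `|ramp x - ramp w| <= `|x - w|.
Proof. exact: le_trans (max_lip _ _ _) (min_lip _ _ _). Qed.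

(** The four terms of [circle_map_clamp] contribute 1, 2N + 1, 2N + 1 and 2 to the constant. *)
Lemma circle_map_lip x w :
  cabs (circle_map N x - circle_map N w) <= (4 * N%:R + 5) * `|x - w|.
Proof.
have N0 := N_ge0; rewrite !circle_map_clamp.
set p := circle_inner N N%:R; set p' := circle_inner N (- N%:R).
set q := N.+1%:R%:C%C : R[i].
have cq : cabs q = N%:R + 1 by rewrite cabs_real ger0_norm// N1.
have cp : cabs p <= N%:R by rewrite (le_trans (cabs_circle_inner_le _))// ger0_norm.
have cp' : cabs p' <= N%:R by rewrite (le_trans (cabs_circle_inner_le _))// normrN ger0_norm.
have c1 : cabs (q - p) <= 2 * N%:R + 1.
  by apply: le_trans (le_cabsD _ _) _; rewrite cabsN; lra.
have c2 : cabs (- q - p') <= 2 * N%:R + 1.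
  by apply: le_trans (le_cabsD _ _) _; rewrite !cabsN; lra.
have -> : forall a b c e a' b' c' e' : R[i],
  a + b * (q - p) + c * (- q - p') + e - (a' + b' * (q - p) + c' * (- q - p') + e') =
  (a - a') + (b - b') * (q - p) + (c - c') * (- q - p') + (e - e').
  by move=> *; ring.
rewrite -!rmorphB.
set D := `|x - w|.
have h1 := le_trans (circle_inner_lip (clamp N%:R x) (clamp N%:R w)) (clamp_lip _ _ _).
have h2 : `|ramp (x - N%:R) - ramp (w - N%:R)| <= D.
  by apply: le_trans (ramp_lip _ _) _; rewrite opprB addrA subrK.
have h3 : `|ramp (- x - N%:R) - ramp (- w - N%:R)| <= D.
  by apply: le_trans (ramp_lip _ _) _; rewrite opprB addrA subrK opprK addrC distrC.
have h4 : `|x - clamp N.+1%:R x - (w - clamp N.+1%:R w)| <= 2 * D.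
  have -> : x - clamp N.+1%:R x - (w - clamp N.+1%:R w) =
    (x - w) - (clamp N.+1%:R x - clamp N.+1%:R w) by ring.
  apply: le_trans (ler_normB _ _) _; have := clamp_lip N.+1%:R x w; rewrite -/D; lra.
apply: le_trans (le_cabsD _ _) _; rewrite cabs_real.
have k1 := le_cabsD (circle_inner N (clamp N%:R x) - circle_inner N (clamp N%:R w)
   + (ramp (x - N%:R) - ramp (w - N%:R))%:C%C * (q - p))
   ((ramp (- x - N%:R) - ramp (- w - N%:R))%:C%C * (- q - p')).
have k2 := le_cabsD (circle_inner N (clamp N%:R x) - circle_inner N (clamp N%:R w))
   ((ramp (x - N%:R) - ramp (w - N%:R))%:C%C * (q - p)).
rewrite cabsM cabs_real in k2; rewrite [cabs (_ * (- q - p'))]cabsM cabs_real in k1.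
have m1 : `|ramp (x - N%:R) - ramp (w - N%:R)| * cabs (q - p) <= D * (2 * N%:R + 1).
  by rewrite ler_pM ?cabs_ge0.
have m2 : `|ramp (- x - N%:R) - ramp (- w - N%:R)| * cabs (- q - p') <= D * (2 * N%:R + 1).
  by rewrite ler_pM ?cabs_ge0.
rewrite -/D in h1; lra.
Qed.

Lemma circle_map0 : circle_map N 0 = 0 :> R[i].
Proof. by rewrite /circle_map normr0 ltr0n N_gt0 circle_inner0. Qed.

(** Half the angle subtended by the arc from 0 to p, so that |p| = 2 kappa sin h and Re p = |p| cos
    h. *)
Let h : R := N%:R / kappa / 2.

Let Nh : N%:R / kappa = h *+ 2.
Proof. by rewrite -[RHS]mulr_natr /h divfK// pnatr_eq0. Qed.

Let h_gt0 : 0 < h.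
Proof. by apply: divr_gt0 => //; apply: divr_gt0 => //; rewrite ltr0n. Qed.

Let hX : h * X ^+ 3 <= 4.
Proof.
have X0 : X != 0 by rewrite gt_eqF// (lt_le_trans _ X_ge2).
have p0 : pi != 0 :> R by rewrite gt_eqF// pi_gt0.
have -> : h * X ^+ 3 = pi * (N%:R / X).
  rewrite /h /kappa nE; move: (pi : R) p0 => p p0; field.
  by rewrite p0 X0.
have NX : N%:R / X <= 1.
  rewrite ler_pdivrMr ?(lt_le_trans _ X_ge2)// mul1r.
  by apply: le_trans N_leX; rewrite ler_nat.
have pi4 : pi <= 4 :> R by have := @pihalf_lt2 R; lra.
have NX0 : 0 <= N%:R / X by rewrite divr_ge0// ltW// (lt_le_trans _ X_ge2).
have : pi * (N%:R / X) <= pi * 1 by rewrite ler_wpM2l// pi_ge0.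
lra.
Qed.

Let h_le : h <= 1 / 2 /\ h * X <= 1.
Proof.
have X2 := X_ge2; have hX3 := hX; have h0 := ltW h_gt0.
have X4 : 4 <= X ^+ 2 by have := @lerXn2r R 2 2 X; rewrite !nnegrE; nra.
have X3 : 8 <= X ^+ 3 by rewrite exprS; nra.
have a1 : h * 8 <= h * X ^+ 3 by rewrite ler_wpM2l.
have a2 : (h * X) * 4 <= (h * X) * X ^+ 2 by rewrite ler_wpM2l// mulr_ge0//; lra.
have a3 : h * X * X ^+ 2 = h * X ^+ 3 by rewrite [in RHS]exprS mulrA.
by split; lra.
Qed.

(** This is where n must be large compared with N: (N + 1)(1 - cos h) is at most X h^2 / 2, hence at
    most h / 2 < 1. *)
Let cos_h : N%:R < N.+1%:R * cos h.
Proof.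
have [h1 h2] := h_le; have h0 := ltW h_gt0.
have c1 := one_sub_cos_le h.
have c2 : N.+1%:R * (1 - cos h) <= N.+1%:R * (h ^+ 2 / 2) by rewrite ler_wpM2l.
have c3 : N.+1%:R * (h ^+ 2 / 2) <= X * (h ^+ 2 / 2).
  by rewrite ler_wpM2r// divr_ge0 ?sqr_ge0.
have c4 : X * (h ^+ 2 / 2) = (h * X) * h / 2 by field.
have c5 : (h * X) * h <= 1 * h by rewrite ler_wpM2r.
rewrite N1 in c2 c3 *; lra.
Qed.

Let p : R[i] := circle_inner N N%:R.

Let angle_le_pi : N%:R / kappa <= pi.
Proof.
rewrite Nh -[leLHS]mulr_natr; have [h1 _] := h_le; have := @pi_ge2 R; lra.
Qed.

Let Re_p_lt : complex.Re p < N.+1%:R.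
Proof.
apply: le_lt_trans (ler_norm _) _; apply: le_lt_trans (normRe_le_cabs _) _.
apply: le_lt_trans (cabs_circle_inner_le _) _.
by rewrite ger0_norm// ltr_nat.
Qed.

(* The interpolation starts in a direction of increasing modulus. *)
Let sqr_p_lt : cabs p ^+ 2 < N.+1%:R * complex.Re p.
Proof.
rewrite /p sqr_cabs_circle_inner circle_innerE /= Nh.
(* In terms of h, after cancelling |p| > 0, the claim reads |p| < (N + 1) cos h, and |p| <= N. *)
rewrite cos_mulr2n sin_mulr2n cos2sin2.
have s0 : 0 < sin h.
  apply: sin_gt0_pi; rewrite h_gt0/=.
  by have [h1 _] := h_le; have := @pi_ge2 R; lra.
have s1 : 2 * kappa * sin h <= N%:R.
  have -> : N%:R = 2 * kappa * h by rewrite /h; field; rewrite gt_eqF.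
  by rewrite ler_wpM2l// ?sin_le_id ?ltW// mulr_gt0.
have c := cos_h.
have s2 : 2 * kappa * sin h < N.+1%:R * cos h by lra.
have s3 : (2 * kappa * sin h) * (2 * kappa * sin h) <
   (N.+1%:R * cos h) * (2 * kappa * sin h).
  by rewrite ltr_pM2r// mulr_gt0// mulr_gt0.
apply: le_lt_trans (lt_le_trans s3 _); rewrite le_eqVlt; apply/orP; left; apply/eqP; ring.
Qed.

Let inner_mono a b : 0 <= a -> a < b -> b <= N%:R ->
  cabs (circle_map N a) ^+ 2 < cabs (circle_map N b) ^+ 2.
Proof.
move=> a0 ab bN.
have E x : 0 <= x -> x <= N%:R -> circle_map N x = circle_inner N x.
  move=> x0 xN; have N0 := N_ge0; rewrite circle_map_clamp.
  have -> : clamp N.+1%:R x = x by rewrite clamp_mid// ger0_norm// N1; lra.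
  have -> : ramp (x - N%:R) = 0 by rewrite ramp_lo//; lra.
  have -> : ramp (- x - N%:R) = 0 by rewrite ramp_lo//; lra.
  by rewrite clamp_mid ?ger0_norm// !rmorph0 !mul0r subrr !addr0.
have b0 := ltW (le_lt_trans a0 ab); have aN := ltW (lt_le_trans ab bN).
rewrite !E//.
rewrite !sqr_cabs_circle_inner ltr_pM2l ?exprn_gt0// ltr_pM2l// ltrD2l ltrN2.
have ki : 0 < kappa^-1 by rewrite invr_gt0.
have ap x : 0 <= x -> x <= N%:R -> x / kappa \in `[0, pi].
  move=> x0 xN; rewrite in_itv/= mulr_ge0 ?(ltW ki)//=.
  by apply: le_trans angle_le_pi; rewrite ler_pM2r.
by rewrite ltr_cos ?ap// ltr_pM2r.
Qed.

(** With u = x - N the squared modulus is P (1 - u)^2 + 2 M u (1 - u) + Q u^2, where P = |p|^2, M =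
    (N + 1) Re p and Q = (N + 1)^2. It increases on [0, 1] because P < M < Q; the difference of two
    values is factored explicitly. *)
Let mid_mono a b : N%:R <= a -> a < b -> b <= N.+1%:R ->
  cabs (circle_map N a) ^+ 2 < cabs (circle_map N b) ^+ 2.
Proof.
move=> aN ab bN1; rewrite N1 in bN1.
have E x : N%:R <= x -> x <= N%:R + 1 -> cabs (circle_map N x) ^+ 2 =
    cabs p ^+ 2 * (N%:R + 1 - x) ^+ 2
    + 2 * (N.+1%:R * complex.Re p) * ((N%:R + 1 - x) * (x - N%:R))
    + N.+1%:R ^+ 2 * (x - N%:R) ^+ 2.
  move=> x0 xN; have N0 := N_ge0; rewrite circle_map_clamp.
  have -> : clamp N.+1%:R x = x by rewrite clamp_mid// ger0_norm ?N1; lra.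
  have -> : clamp N%:R x = N%:R by rewrite clamp_hi.
  have -> : ramp (x - N%:R) = x - N%:R by rewrite ramp_mid//; lra.
  have -> : ramp (- x - N%:R) = 0 by rewrite ramp_lo//; lra.
  rewrite -/p !sqr_cabs; case: (p) => u v /=.
  ring.
rewrite !E//; [|lra|lra].
have M := sqr_p_lt.
have Q : N.+1%:R * complex.Re p < N.+1%:R ^+ 2 by rewrite expr2 ltr_pM2l// ltr0n.
move: (cabs p ^+ 2) (N.+1%:R * complex.Re p) (N.+1%:R ^+ 2) M Q => P' M' Q' M Q.
set u := a - N%:R; set v := b - N%:R.
have -> : N%:R + 1 - a = 1 - u by rewrite /u; ring.
have -> : N%:R + 1 - b = 1 - v by rewrite /v; ring.
have uv : u < v by rewrite /u /v; lra.
have u0 : 0 <= u by rewrite /u; lra.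
have v1 : v <= 1 by rewrite /v; lra.
rewrite -subr_gt0.
have -> : P' * (1 - v) ^+ 2 + 2 * M' * ((1 - v) * v) + Q' * v ^+ 2 -
   (P' * (1 - u) ^+ 2 + 2 * M' * ((1 - u) * u) + Q' * u ^+ 2) =
   (v - u) * ((2 - u - v) * (M' - P') + (u + v) * (Q' - M')) by ring.
rewrite mulr_gt0 ?subr_gt0// addr_gt0// mulr_gt0 ?subr_gt0//; lra.
Qed.

Let out_mono a b : N.+1%:R <= a -> a < b ->
  cabs (circle_map N a) ^+ 2 < cabs (circle_map N b) ^+ 2.
Proof.
have N0 := N_ge0.
have E x : N.+1%:R <= x -> cabs (circle_map N x) = x.
  move=> xN; have x0 : 0 <= x by rewrite N1 in xN; lra.
  have xN' : (x < N%:R) = false by apply/negbTE; rewrite -leNgt; rewrite N1 in xN; lra.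
  by rewrite /circle_map ger0_norm// xN' xN cabs_real ger0_norm.
move=> aN ab; rewrite !E//; last exact: le_trans aN (ltW ab).
by rewrite N1 in aN; rewrite ltrXn2r ?nnegrE//; lra.
Qed.

Let circle_map_mono_ge0 a b : 0 <= a -> a < b ->
  cabs (circle_map N a) < cabs (circle_map N b).
Proof.
move=> a0 ab; rewrite -ltr_sqr ?nnegrE ?cabs_ge0//.
pose f x := cabs (circle_map N x) ^+ 2; rewrite -/(f a) -/(f b).
(* Strict monotonicity passes to the union of two intervals sharing an endpoint; it is used twice,
   at N and at N + 1. *)
have glue (c : R) : (forall x y, 0 <= x -> x < y -> y <= c -> f x < f y) ->
    forall e, c <= e -> (forall x y, c <= x -> x < y -> y <= e -> f x < f y) ->
    forall x y, 0 <= x -> x < y -> y <= e -> f x < f y.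
  move=> lo e ce hi x y x0 xy ye.
  have [yc|cy] := leP y c; first exact: lo.
  have [cx|xc] := leP c x; first exact: hi.
  by apply: lt_trans (lo x c x0 xc (lexx c)) (hi c y (lexx c) cy ye).
have N1' : N%:R <= N.+1%:R :> R by rewrite ler_nat.
have f1 := glue _ inner_mono _ N1' mid_mono.
have [bN|Nb] := leP b N.+1%:R; first exact: f1.
apply: (glue _ f1 b (ltW Nb)) => // x y xN xy _; exact: out_mono.
Qed.

Lemma circle_map_mono x w :
  (cabs (circle_map N x) < cabs (circle_map N w)) = (`|x| < `|w|).
Proof.
rewrite (cabs_circle_map_norm x) (cabs_circle_map_norm w).
have [xw|wx|->] := ltgtP `|x| `|w|.
- exact: circle_map_mono_ge0.
- by apply/negbTE; rewrite -leNgt ltW// circle_map_mono_ge0.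
- exact: ltxx.
Qed.

Lemma circle_map_lip_small B x w : B < N%:R -> `|x| <= B -> `|w| <= B ->
  cabs (circle_map N x - circle_map N w) <= `|x - w|.
Proof.
move=> BN xB wB; rewrite /circle_map !(le_lt_trans _ BN)//.
exact: circle_inner_lip.
Qed.

End CircleMapFacts.

(** * The embedding into C, and the two cases of the theorem *)

Section ToC.
Context {R : realType} {d : nat}.
Implicit Types x w : 'rV[R]_d.

Lemma toCB x w : toC (x - w) = toC x - toC w.
Proof.
by rewrite /toC -sumrB; apply: eq_bigr => j _; rewrite !mxE rmorphB mulrBl.
Qed.

End ToC.

Lemma toC1 (R : realType) (x : 'rV[R]_1) : toC x = (x 0 0)%:C%C.
Proof. by rewrite /toC big_ord1 expr0 mulr1. Qed.

Lemma toC2 (R : realType) (x : 'rV[R]_2) : toC x = (x 0 0 +i* x 0 (lift 0 0))%C.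
Proof.
rewrite /toC !big_ord_recl big_ord0 expr0 mulr1 addr0 expr1.
by apply/eqP; rewrite eq_complex /=; apply/andP; split; apply/eqP; ring.
Qed.

Lemma enorm1 (R : realType) (x : 'rV[R]_1) : enorm x = `|x 0 0|.
Proof. by rewrite /enorm big_ord1 sqrtr_sqr. Qed.

Lemma cabs_toC (R : realType) (d : nat) (x : 'rV[R]_d) :
  d = 1%N \/ d = 2%N -> cabs (toC x) = enorm x.
Proof.
move=> dE; case: dE x => -> x; first by rewrite toC1 cabs_real enorm1.
by rewrite toC2 cabsE /enorm !big_ord_recl big_ord0 addr0.
Qed.

Theorem theorem6p2 (R : realType) (d : nat) (S : set 'rV[R]_d)
    (S_closed : closed S) (S_0 : S 0) (S_regular : closure (interior S) = S)
    (b : nat -> nat)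
    (b_incr : forall r s, (0 < r)%N -> (r < s)%N -> (b r < b s)%N)
    (mu : nat -> probability (config_space S) R)
    (beta : R)
    (varpi : nat -> 'rV[R]_d -> R[i])
    (varpi_case :
      ((d = 1%N \/ d = 2%N) /\ forall N x, varpi N x = toC x) \/
      (d = 1%N /\ forall N x, varpi N x = circle_map N (complex.Re (toC x))))
    (A6 : forall r, (0 < r)%N -> exists l0, [/\ (0 < l0)%N,
        compl_vanish mu (Ubar_ b varpi r l0) &
        forall l, (1 <= l < l0)%N -> compl_vanish mu (U_ b varpi r l)]) :
  forall r, (0 < r)%N -> compl_vanish mu (H_ b varpi beta r).
Proof.
have [[d12 vE]|[d1 vE]] := varpi_case.
  have lip N x w : cabs (varpi N x - varpi N w) <= 1 * enorm (x - w).
    by rewrite !vE -toCB cabs_toC// mul1r.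
  apply: A5_of_A6 A6 => //.
  - by case: d12 => ->.
  - by move=> N _; rewrite vE -(subrr (0 : 'rV[R]_d)) toCB subrr.
  - by move=> N _; exists 1.
  - by move=> B; exists 1.
  - by move=> N _ x w; rewrite !vE !cabs_toC.
move: S S_closed S_0 S_regular mu varpi varpi_case vE A6.
rewrite d1 => S' S_closed' S_0' S_regular' mu' varpi' _ vE A6'.
have vcm N x : varpi' N x = circle_map N (x 0 0) by rewrite vE toC1.
apply: A5_of_A6 A6' => //.
- by move=> N N0; rewrite vcm mxE circle_map0.
- move=> N N0; exists (4 * N%:R + 5) => x w.
  by rewrite !vcm enorm1 !mxE circle_map_lip.
- move=> B; pose C := Num.max B 0.
  have C0 : 0 <= C by rewrite le_max lexx orbT.
  (* If B < N, both points lie on the circle part and the constant is 1. If N <= B, the constant 4 N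
     + 5 is at most 4 C + 5. *)
  exists (4 * C + 5) => N N0 x w; rewrite !vcm !enorm1 !mxE => xB wB.
  have [BN|NB] := ltP B N%:R.
    apply: le_trans (circle_map_lip_small N0 BN xB wB) _.
    by rewrite ler_peMl//; lra.
  apply: le_trans (circle_map_lip N0 _ _) _; rewrite ler_wpM2r//.
  have : N%:R <= C by rewrite le_max NB.
  lra.
- by move=> N N0 x w; rewrite !vcm !enorm1 circle_map_mono.
Qed.
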